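(* Let $n\ge 2$ be an integer and let $\mathcal{M}$ be a factor von Neumann algebra containing a nontrivial projection. Then a map $\varphi:\mathcal{M}\to\mathcal{M}$ is a bijective unital multiplicative $*$-Jordan $n$-map if and only if $\varphi$ is a $*$-ring isomorphism.
   Context: A von Neumann algebra is a weakly closed, self-adjoint algebra of operators on a complex Hilbert space containing the identity operator $I$; it is a factor if its center contains only the scalar operators. A projection is a self-adjoint idempotent; it is nontrivial if it is neither $0$ nor $I$. For elements $A,B$ of a $*$-ring, $\{A,B\}_*:=AB+BA^*$ (the $*$-Jordan product). Define $q_{1*}(x)=x$ and $q_{n*}(x_1,\dots,x_n)=\{q_{(n-1)*}(x_1,\dots,x_{n-1}),x_n\}_*$ for $n\ge 2$. A map $\varphi$ (not necessarily additive) is a multiplicative $*$-Jordan $n$-map if $\varphi(q_{n*}(x_1,\dots,x_n))=q_{n*}(\varphi(x_1),\dots,\varphi(x_n))$ for all $x_1,\dots,x_n$. Unital means $\varphi(I)=I$. A $*$-ring isomorphism is a bijective map that is additive, multiplicative and satisfies $\varphi(A^* )=\varphi(A)^*$ (complex linearity is not required). *)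

(* Defs.v *)
From HB Require Import structures.
From mathcomp Require Import all_boot all_order all_algebra.
From mathcomp Require Import all_classical all_reals all_analysis.
From mathcomp Require Import complex ring lra.

Set Implicit Arguments.
Unset Strict Implicit.
Unset Printing Implicit Defensive.

Import Order.TTheory GRing.Theory Num.Theory.
Import numFieldNormedType.Exports.

Local Open Scope classical_set_scope.
Local Open Scope ring_scope.
Local Open Scope complex_scope.

(* The complex numbers as one fixed structure: on the bare type [R[i]], unification
   reaches the algebraic structures along several convertible paths that are not
   syntactically equal, which defeats rewriting. *)
Definition Cplx (R : realType) : numClosedFieldType := R[i].

(* [dotp] is linear in its first argument and conjugate-linear in its second. *)
HB.mixin Record CompleteNormedModule_isHilbert (R : realType) H
    & CompleteNormedModule (Cplx R) H := {
  dotp : {dot H for (@Num.conj (Cplx R))} ;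
  dotp_norm : forall x : H, `|x| ^+ 2 = dotp x x }.

#[short(type="hilbertType")]
HB.structure Definition Hilbert (R : realType) :=
  { H of CompleteNormedModule_isHilbert R H
       & CompleteNormedModule (Cplx R) H }.

Section Riesz.
Context {R : realType} {H : hilbertType R}.
Implicit Types (x y z : H) (a : Cplx R).

Lemma dotpDl x y z : dotp (x + y) z = dotp x z + dotp y z.
Proof. exact: linearDl. Qed.
Lemma dotpDr x y z : dotp z (x + y) = dotp z x + dotp z y.
Proof. exact: linearDr. Qed.
Lemma dotpZl a x z : dotp (a *: x) z = a * dotp x z.
Proof. exact: linearZl_LR. Qed.
Lemma dotpZr a x z : dotp z (a *: x) = (Num.conj a) * dotp z x.
Proof. exact: linearZr_LR. Qed.
Lemma dotpC x y : dotp x y = Num.conj (dotp y x).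
Proof. by rewrite hermC expr0 mul1r. Qed.
Lemma dotpBl x y z : dotp (x - y) z = dotp x z - dotp y z.
Proof. exact: linearBl. Qed.
Lemma dotpBr x y z : dotp z (x - y) = dotp z x - dotp z y.
Proof. exact: linearBr. Qed.

Lemma dotp_inj x y : (forall z, dotp z x = dotp z y) -> x = y.
Proof.
move=> xy; apply/eqP; rewrite -subr_eq0 -normr_eq0 -sqrf_eq0 dotp_norm.
by rewrite dotpBr xy subrr.
Qed.

Lemma CauchySchwarz_dotp x y : `|dotp x y| <= `|x| * `|y|.
Proof.
have [->|y0] := eqVneq y 0; first by rewrite linear0r !normr0 mulr0.
have yy : 0 < dotp y y by rewrite dnorm_gt0.
rewrite -(@ler_pXn2r _ 2%N) ?nnegrE ?mulr_ge0// exprMn !dotp_norm.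
have := dnorm_ge0 dotp (dotp y y *: x - dotp x y *: y).
rewrite dotpBl !dotpBr !dotpZl !dotpZr -(dotpC y x) -(dotpC y y) !mulrA.
have -> : dotp y y * dotp y y * dotp x x - dotp y y * dotp y x * dotp x y
   - (dotp x y * dotp y y * dotp y x - dotp x y * dotp y x * dotp y y) =
   dotp y y * (dotp x x * dotp y y - dotp x y * dotp y x) by ring.
by rewrite pmulr_rge0// subr_ge0 (dotpC y x) -normCK.
Qed.

Let re (a : Cplx R) : R := complex.Re a.
Let rc (k : R) : Cplx R := k%:C.

Let reD a b : re (a + b) = re a + re b.
Proof. by case: a b => [? ?] []. Qed.
Let reN a : re (- a) = - re a.
Proof. by case: a. Qed.
Let reZ k a : re (rc k * a) = k * re a.
Proof. by case: a => u v; rewrite /re/= mul0r subr0. Qed.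
Let re_conj a : re (Num.conj a) = re a.
Proof. by case: a. Qed.
Let re_rc k : re (rc k) = k.
Proof. by []. Qed.
Let re_le (a b : Cplx R) : a <= b -> re a <= re b.
Proof. by move=> ab; have : (a : R[i]) <= b := ab; rewrite lecE => /andP[]. Qed.
Let rcM k l : rc (k * l) = rc k * rc l.
Proof. exact: rmorphM. Qed.
Let rcX k n : rc (k ^+ n) = rc k ^+ n.
Proof. exact: rmorphXn. Qed.
Let rc_re a : 0 <= a -> rc (re a) = a.
Proof. by move=> a0; exact: RRe_real (ger0_real a0). Qed.
Let rc_lt k l : (rc k < rc l) = (k < l).
Proof. exact: ltcR. Qed.
Let rc_norm k : `|rc k| = rc `|k|.
Proof.
have ge0 l : 0 <= l -> 0 <= rc l by move=> l0; exact: (etrans (ler0c l) l0).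
case: (lerP 0 k) => k0; first by rewrite (ger0_norm k0) ger0_norm ?ge0.
have rcN : rc (- k) = - rc k by exact: rmorphN.
by rewrite (ltr0_norm k0) -normrN -rcN ger0_norm// ge0// oppr_ge0 ltW.
Qed.
Let rc_inj : injective rc.
Proof. exact: complexI. Qed.
Let sqn a : re (`|a| ^+ 2) = complex.Re a ^+ 2 + complex.Im a ^+ 2.
Proof.
have -> : `|a| ^+ 2 = (complex.Re a ^+ 2 + complex.Im a ^+ 2)%:C.
  exact: esym (add_Re2_Im2 _).
by [].
Qed.
Let sqnD a b : re (`|a + b| ^+ 2) <= re (`|a| ^+ 2) *+ 2 + re (`|b| ^+ 2) *+ 2.
Proof.
rewrite !sqn; case: a b => [u v] [u' v'] /=.
have := sqr_ge0 (u - u'); have := sqr_ge0 (v - v'); nra.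
Qed.
Let re_norm a : re a <= re `|a|.
Proof.
have n0 : 0 <= re `|a| by exact: (@re_le 0).
apply: le_trans (ler_norm _) _; rewrite -(@ler_pXn2r _ 2%N) ?nnegrE//.
have -> : re `|a| ^+ 2 = re (`|a| ^+ 2).
  by apply: rc_inj; rewrite rcX !rc_re// exprn_ge0.
by rewrite sqn real_normK ?num_real// lerDl sqr_ge0.
Qed.

(* The representing vector minimizes |x|^2 - 2 Re (f x). *)
Lemma riesz (f : H -> Cplx R) (c : Cplx R) : {morph f : x y / x + y} ->
  (forall a, {morph f : x / a *: x >-> a * x}) ->
  (forall x, `|f x| <= c * `|x|) ->
  exists y, forall x, f x = dotp x y.
Proof.
move=> fD fZ fb.
pose N x : R := re (dotp x x).
have NE x : rc (N x) = dotp x x by rewrite rc_re// dnorm_ge0.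
pose r x : R := re `|x|.
have rE x : rc (r x) = `|x| by rewrite rc_re.
have r0 x : 0 <= r x by exact: (@re_le 0).
have NrE x : N x = r x ^+ 2.
  by apply: rc_inj; rewrite NE rcX rE dotp_norm.
have N0 x : 0 <= N x by rewrite NrE sqr_ge0.
have ND x y : N (x + y) = N x + N y + re (dotp x y) *+ 2.
  rewrite /N dotpDl !dotpDr !reD (dotpC y x) re_conj; ring.
have NZ a x : N (a *: x) = re (`|a| ^+ 2) * N x.
  rewrite /N dotpZl dotpZr mulrA -normCK.
  by rewrite -(rc_re (exprn_ge0 2 (normr_ge0 a))) reZ.
clearbody N r.
pose J x : R := N x - re (f x) *+ 2.
have JB x : - (re `|c|) ^+ 2 <= J x.
  have h : re (f x) <= re `|c| * r x.
    apply: le_trans (re_norm _) _.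
    rewrite -(re_rc (r x)) rE -reZ rc_re//; apply: re_le.
    rewrite (le_trans (fb x))//.
    have [x0|x0] := eqVneq `|x| 0; first by rewrite x0 !mulr0.
    rewrite ler_wpM2r//; apply: real_ler_norm; apply: ger0_real.
    by have := le_trans (normr_ge0 _) (fb x); rewrite pmulr_lge0// lt_def x0/=.
  have := sqr_ge0 (re `|c| - r x).
  rewrite /J NrE; nra.
pose m := inf (range J).
have Jlb : has_lbound (range J) by exists (- (re `|c|) ^+ 2) => _ [x _ <-].
have mJ x : m <= J x by apply: ge_inf => //; exists x.
have mJe e : 0 < e -> exists x, J x < m + e.
  move=> e0; have [|_ [x _ <-] xe] := @inf_adherent _ (range J) e e0.
    by split => //; exists (J 0); exists 0.
  by exists x.
have dist x y e : J x < m + e -> J y < m + e -> N (x - y) < 4 * e.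
  move=> xe ye; have mJh := mJ (rc 2^-1 *: (x + y)).
  have E : J (rc 2^-1 *: (x + y)) *+ 4 + N (x - y) = (J x + J y) *+ 2.
    rewrite /J NZ fZ reZ rc_norm -rcX re_rc fD reD !ND -[- y]scaleN1r NZ.
    rewrite normrN1 expr1n (re_rc 1) dotpZr rmorphN1 mulN1r reN.
    by rewrite ger0_norm ?invr_ge0//; field.
  by move: E xe ye mJh; rewrite -mulr_natl; lra.
pose d x z := re (`|f z - dotp z x| ^+ 2).
have dE x z : rc (d x z) = `|f z - dotp z x| ^+ 2 by rewrite rc_re// exprn_ge0.
have d0 x z : 0 <= d x z by rewrite /d sqn addr_ge0 ?sqr_ge0.
have dlt x z e : 0 < e -> J x < m + e -> d x z < e * (N z + 1).
  move=> e0 xe; pose s := (N z + 1)^-1.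
  pose a := rc s * Num.conj (f z - dotp z x).
  have E : J (x + a *: z) = J x + s ^+ 2 * d x z * N z - s * d x z *+ 2.
    rewrite /J ND NZ fD fZ dotpZr !reD.
    have -> : re (Num.conj a * dotp x z) = re (a * dotp z x).
      by rewrite (dotpC x z) -rmorphM re_conj.
    have -> : re (`|a| ^+ 2) = s ^+ 2 * d x z.
      rewrite /a normrM norm_conjC exprMn rc_norm -rcX reZ.
      by rewrite real_normK ?num_real.
    have : re (a * f z) - re (a * dotp z x) = s * d x z.
      rewrite -reN -reD -mulrBr /a -mulrA reZ mulrC [X in re X]mulrC.
      by rewrite -normCK mulrC.
    by lra.
  have := mJ (x + a *: z); rewrite E.
  have Nz1 : 0 < N z + 1 by have := N0 z; lra.
  have sN : s * (N z + 1) = 1 by rewrite /s mulVf// gt_eqF.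
  have s0 : 0 < s by rewrite invr_gt0.
  rewrite -ltr_pdivrMr// -/s => h.
  have sd : 0 <= s * d x z by rewrite mulr_ge0// ltW.
  have : s ^+ 2 * d x z * N z <= s * d x z.
    have -> : s ^+ 2 * d x z * N z = s * d x z * (s * N z) by ring.
    by rewrite ler_piMr//; lra.
  by rewrite mulrC; lra.
pose F := filter_from [set e : R | 0 < e] (fun e => [set x | J x < m + e]).
have FF : ProperFilter F.
  apply: filter_from_proper; last by move=> e /mJe.
  apply: filter_from_filter; first by exists 1 => /=.
  move=> e e' /= e0 e'0; exists (Num.min e e'); first by rewrite /= lt_min e0.
  move=> x /= xe; split; rewrite /= (lt_le_trans xe)// lerD2l.
    by rewrite ge_min lexx.
  by rewrite ge_min lexx orbT.
have rball x y (e : R) : 0 < e -> N (x - y) < e ^+ 2 -> ball x (rc e) y.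
  move=> e0 h; rewrite -ball_normE /ball_/= -rE rc_lt.
  by rewrite -(@ltr_pXn2r _ 2%N) ?nnegrE ?(ltW e0)// -NrE.
have cF : cvg F.
  apply/cauchy_cvgP/cauchy_ballP => // e e0.
  have [k k0 ->] : exists2 k : R, 0 < k & e = rc k.
    exists (re e); last by rewrite rc_re// ltW.
    by rewrite -rc_lt rc_re// ltW.
  exists ([set x | J x < m + k ^+ 2 / 4], [set x | J x < m + k ^+ 2 / 4]).
    have k4 : 0 < k ^+ 2 / 4 by rewrite divr_gt0// exprn_gt0.
    by split; exists (k ^+ 2 / 4).
  move=> [x y] [/= xk yk]; apply: rball => //.
  by rewrite (lt_le_trans (dist _ _ _ xk yk))// mulrC divfK.
exists (lim F) => z.
apply/eqP; rewrite -subr_eq0 -normr_eq0 -sqrf_eq0 -dE; apply/eqP.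
suff : d (lim F) z = 0 by move=> ->.
apply/eqP; rewrite eq_le d0 andbT.
apply/ler_addgt0Pr => e e0; rewrite add0r.
have Nz1 : 0 < N z + 1 by have := N0 z; lra.
pose k := e / (4 * (N z + 1)).
have k0 : 0 < k by rewrite divr_gt0// mulr_gt0.
have ke : k * (N z + 1) *+ 4 = e by rewrite /k; field; rewrite gt_eqF.
have FS : F [set x | J x < m + k] by exists k.
have FB : F (ball (lim F) (rc (Num.sqrt k))).
  by apply: cF; apply: nbhsx_ballx; rewrite (rc_lt 0) sqrtr_gt0.
have [x [/= xk xB]] := filter_ex (filterI FS FB).
have Nx : N (lim F - x) < k.
  move: xB; rewrite -ball_normE /ball_/= -rE rc_lt => xB.
  by rewrite NrE -[ltRHS]sqr_sqrtr ?ltW// ltr_pXn2r ?nnegrE ?sqrtr_ge0.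
have dx := dlt _ z _ k0 xk.
have h1 : re (`|- dotp z (lim F - x)| ^+ 2) <= N z * N (lim F - x).
  rewrite normrN.
  have -> : N z * N (lim F - x) = re ((`|z| * `|lim F - x|) ^+ 2).
    by rewrite -!rE -rcM -rcX re_rc exprMn -!NrE.
  by apply: re_le; rewrite ler_pXn2r ?nnegrE ?mulr_ge0// CauchySchwarz_dotp.
have := sqnD (f z - dotp z x) (- dotp z (lim F - x)).
have -> : f z - dotp z x + - dotp z (lim F - x) = f z - dotp z (lim F).
  by rewrite dotpBr; ring.
rewrite -/(d (lim F) z) -/(d x z) => h2.
have := N0 z; nra.
Qed.
End Riesz.

Section BoundedOperators.
Context {R : realType}.

Record bop (H : hilbertType R) : Type := BOp {
  bop_fun :> {linear H -> H} ;
  bop_continuous : continuous bop_fun }.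

End BoundedOperators.

Notation "''B' ( H )" := (bop H) (at level 8, format "''B' ( H )") : type_scope.

Section BoundedOperatorsAlgebra.
Context {R : realType} {H : hilbertType R}.
Implicit Types (A B C : 'B(H)) (x y : H) (a : Cplx R).

HB.instance Definition _ := gen_eqMixin 'B(H).
HB.instance Definition _ := gen_choiceMixin 'B(H).

Lemma bopP A B : A =1 B -> A = B.
Proof.
case: A B => [f cf] [g cg] /= fg.
have efg : f = g.
  case: f g fg {cf cg} => [f [[[f0 fD]] [fZ]]] [g [[[g0 gD]] [gZ]]] /=.
  move=> /funext fg.
  rewrite fg in f0 fD fZ *.
  rewrite (Prop_irrelevance f0 g0) (Prop_irrelevance fD gD).
  by rewrite (Prop_irrelevance fZ gZ).
rewrite efg in cf *; congr BOp; exact: Prop_irrelevance.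
Qed.

Lemma bop_bounded A : exists2 c : Cplx R, 0 <= c & forall x, `|A x| <= c * `|x|.
Proof.
have /linear_bounded_continuous/linear_boundedP := @bop_continuous _ _ A.
by move=> /pinfty_ex_gt0 [c c0 Ac]; exists c => //; exact: ltW.
Qed.

Lemma linear_bounded_bop (f : {linear H -> H}) (c : Cplx R) : 0 <= c ->
  (forall x, `|f x| <= c * `|x|) -> continuous f.
Proof.
move=> c0 fc; apply/linear_bounded_continuous/linear_boundedP.
exists c; split; first exact: ger0_real.
by move=> k ck x; rewrite (le_trans (fc x))// ler_wpM2r// ltW.
Qed.

Section build.
Variables (f : H -> H) (fD : {morph f : x y / x + y}).
Variables (fZ : forall a, {morph f : x / a *: x}).

Let f0 : f 0 = 0.
Proof. by apply: (addrI (f 0)); rewrite -fD !addr0. Qed.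

HB.instance Definition _ :=
  GRing.isNmodMorphism.Build H H f (conj f0 fD).
HB.instance Definition _ := GRing.isScalable.Build (Cplx R) H H *:%R f fZ.

Definition mk_bop (c : Cplx R) (c0 : 0 <= c)
    (fc : forall x, `|f x| <= c * `|x|) : 'B(H) :=
  BOp (@linear_bounded_bop f c c0 fc).

End build.


Definition bop_zero : 'B(H) := @BOp R H \0 (@cst_continuous H H 0).
Definition bop_opp A : 'B(H) :=
  @BOp R H (\- A) (fun x => continuousN (@bop_continuous _ _ A x)).
Definition bop_add A B : 'B(H) :=
  @BOp R H (A \+ B)
    (fun x => continuousD (@bop_continuous _ _ A x) (@bop_continuous _ _ B x)).
Definition bop_one : 'B(H) := @BOp R H idfun (fun x => cvg_id).
Definition bop_mul A B : 'B(H) :=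
  @BOp R H (A \o B)
    (fun x => continuous_comp (@bop_continuous _ _ B x)
                (@bop_continuous _ _ A (B x))).
Definition bop_scale a A : 'B(H) :=
  @BOp R H (a \*: A) (fun x => continuousZr (@bop_continuous _ _ A x)).

Let bop_addA : associative bop_add.
Proof. by move=> A B C; apply: bopP => x /=; rewrite addrA. Qed.
Let bop_addC : commutative bop_add.
Proof. by move=> A B; apply: bopP => x /=; rewrite addrC. Qed.
Let bop_add0 : left_id bop_zero bop_add.
Proof. by move=> A; apply: bopP => x /=; rewrite add0r. Qed.
Let bop_addN : left_inverse bop_zero bop_opp bop_add.
Proof. by move=> A; apply: bopP => x /=; rewrite addNr. Qed.
HB.instance Definition _ :=
  GRing.isZmodule.Build 'B(H) bop_addA bop_addC bop_add0 bop_addN.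

Let bop_mulA : associative bop_mul.
Proof. by move=> A B C; apply: bopP. Qed.
Let bop_mul1l : left_id bop_one bop_mul.
Proof. by move=> A; apply: bopP. Qed.
Let bop_mul1r : right_id bop_one bop_mul.
Proof. by move=> A; apply: bopP. Qed.
Let bop_mulDl : left_distributive bop_mul +%R.
Proof. by move=> A B C; apply: bopP. Qed.
Let bop_mulDr : right_distributive bop_mul +%R.
Proof. by move=> A B C; apply: bopP => x /=; rewrite linearD. Qed.
HB.instance Definition _ := GRing.Zmodule_isPzRing.Build 'B(H)
  bop_mulA bop_mul1l bop_mul1r bop_mulDl bop_mulDr.

Let bop_scaleA a b A : bop_scale a (bop_scale b A) = bop_scale (a * b) A.
Proof. by apply: bopP => x /=; rewrite scalerA. Qed.
Let bop_scale1 : left_id 1 bop_scale.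
Proof. by move=> A; apply: bopP => x /=; rewrite scale1r. Qed.
Let bop_scaleDr : right_distributive bop_scale +%R.
Proof. by move=> a A B; apply: bopP => x /=; rewrite scalerDr. Qed.
Let bop_scaleDl A : {morph bop_scale^~ A : a b / a + b}.
Proof. by move=> a b; apply: bopP => x /=; rewrite scalerDl. Qed.
HB.instance Definition _ := GRing.Zmodule_isLmodule.Build (Cplx R) 'B(H)
  bop_scaleA bop_scale1 bop_scaleDr bop_scaleDl.

Lemma bop0E x : (0 : 'B(H)) x = 0. Proof. by []. Qed.
Lemma bopDE A B x : (A + B) x = A x + B x. Proof. by []. Qed.
Lemma bopNE A x : (- A) x = - A x. Proof. by []. Qed.
Lemma bop1E x : (1 : 'B(H)) x = x. Proof. by []. Qed.
Lemma bopME A B x : (A * B) x = A (B x). Proof. by []. Qed.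
Lemma bopZE a A x : (a *: A) x = a *: A x. Proof. by []. Qed.

Lemma adj_exists A : exists B, forall x y, dotp (A x) y = dotp x (B y).
Proof.
have [c c0 Ac] := bop_bounded A.
have /choice[g gP] y : exists z, forall x, dotp (A x) y = dotp x z.
  apply: (@riesz _ _ (fun x => dotp (A x) y) (c * `|y|)).
  - by move=> u v; rewrite linearD dotpDl.
  - by move=> a u; rewrite linearZ dotpZl.
  move=> x; rewrite (le_trans (CauchySchwarz_dotp _ _))// mulrAC.
  by rewrite ler_wpM2r.
have gD : {morph g : x y / x + y}.
  by move=> u v; apply: dotp_inj => x; rewrite -gP !dotpDr !gP.
have gZ a : {morph g : x / a *: x}.
  by move=> u; apply: dotp_inj => x; rewrite -gP !dotpZr gP.
have gc x : `|g x| <= c * `|x|.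
  have [->|g0] := eqVneq (g x) 0; first by rewrite normr0 mulr_ge0.
  rewrite -(@ler_pM2l _ `|g x|) ?normr_gt0// -expr2 dotp_norm -gP.
  rewrite -(@ger0_norm _ (dotp _ _)); last by rewrite gP dnorm_ge0.
  rewrite (le_trans (CauchySchwarz_dotp _ _))// mulrA ler_wpM2r//.
  by rewrite mulrC.
by exists (mk_bop gD gZ c0 gc) => x y; rewrite gP.
Qed.

Definition adj A : 'B(H) := sval (cid (adj_exists A)).

Lemma adjP A x y : dotp (A x) y = dotp x (adj A y).
Proof. exact: (svalP (cid (adj_exists A))). Qed.

Lemma adj_unique A B : (forall x y, dotp (A x) y = dotp x (B y)) -> B = adj A.
Proof.
by move=> AB; apply: bopP => y; apply: dotp_inj => x; rewrite -AB adjP.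
Qed.

Lemma adjK : involutive adj.
Proof.
move=> A; apply/esym/adj_unique => x y.
by rewrite dotpC -adjP -dotpC.
Qed.

Lemma adjD : {morph adj : A B / A + B}.
Proof.
move=> A B; apply/esym/adj_unique => x y.
by rewrite !bopDE dotpDl dotpDr !adjP.
Qed.

Lemma adjM A B : adj (A * B) = adj B * adj A.
Proof. by apply/esym/adj_unique => x y; rewrite !bopME !adjP. Qed.

Lemma adjZ a A : adj (a *: A) = Num.conj a *: adj A.
Proof.
by apply/esym/adj_unique => x y; rewrite !bopZE dotpZl dotpZr conjCK adjP.
Qed.

Lemma adj1 : adj 1 = 1.
Proof. exact/esym/adj_unique. Qed.

End BoundedOperatorsAlgebra.

(* The weak operator topology on 'B(H): the coarsest one making all matrix
   coefficients A |-> dotp (A x) y continuous. *)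
Definition wot {R : realType} (H : hilbertType R) : topologicalType :=
  initial_topology
    (fun (A : 'B(H)) => (fun p => dotp (A p.1) p.2) : {ptws H * H -> Cplx R}).

Section VonNeumannAlgebras.
Context {R : realType} {H : hilbertType R}.
Implicit Types (A B P Z : 'B(H)) (M : set 'B(H)).

Record von_neumann_algebra M : Prop := {
  vNa1 : M 1 ;
  vNaD : forall A B, M A -> M B -> M (A + B) ;
  vNaZ : forall (a : Cplx R) A, M A -> M (a *: A) ;
  vNaM : forall A B, M A -> M B -> M (A * B) ;
  vNa_adj : forall A, M A -> M (adj A) ;
  vNa_closed : closed (M : set (wot H)) }.

Definition vN_center M := [set Z | M Z /\ forall A, M A -> Z * A = A * Z].

Definition vN_factor M :=
  von_neumann_algebra M /\ vN_center M `<=`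
    range (fun a : Cplx R => a *: (1 : 'B(H))).

Definition is_projection P := adj P = P /\ P * P = P.

Definition nontrivial_projection P := [/\ is_projection P, P <> 0 & P <> 1].

Definition sjordan A B := A * B + B * adj A.

Definition sjordan_seq (s : seq 'B(H)) :=
  if s is A :: s' then foldl sjordan A s' else 0.

Lemma sjordan_seq1 A : sjordan_seq [:: A] = A.
Proof. by []. Qed.

Lemma sjordan_seq_rcons A s B :
  sjordan_seq (rcons (A :: s) B) = sjordan (sjordan_seq (A :: s)) B.
Proof. exact: foldl_rcons. Qed.

Definition sjordan_nmap n M (phi : 'B(H) -> 'B(H)) :=
  forall x : n.-tuple 'B(H), (forall i, M (tnth x i)) ->
    phi (sjordan_seq x) = sjordan_seq (map_tuple phi x).

Record star_ring_isomorphism M (phi : 'B(H) -> 'B(H)) : Prop := {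
  sri_bij : set_bij M M phi ;
  sriD : forall A B, M A -> M B -> phi (A + B) = phi A + phi B ;
  sriM : forall A B, M A -> M B -> phi (A * B) = phi A * phi B ;
  sri_adj : forall A, M A -> phi (adj A) = adj (phi A) }.

End VonNeumannAlgebras.

(* Main.v *)
Require Import Defs.
From mathcomp Require Import all_boot all_order all_algebra.
From mathcomp Require Import all_classical all_reals all_analysis.
From mathcomp Require Import complex ring lra.

Set Implicit Arguments.
Unset Strict Implicit.
Unset Printing Implicit Defensive.

Import Order.TTheory GRing.Theory Num.Theory.
Import numFieldNormedType.Exports.

Local Open Scope classical_set_scope.
Local Open Scope ring_scope.

(** Products whose first [n - 2] entries are 1 reduce to [A B + B A^*] up to a
    power of 2, and unitality turns that power into a homogeneity of [phi].
    Hence, for every [n], [phi] preserves the binary product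
    [hjordan A B = (A B + B A^* ) / 2], without any additivity
    ([nmap_hjordan]).

    Additivity comes from a Peirce decomposition for complementary projections
    [E] and [F]. Given [A] and [B], surjectivity provides [T] with
    [phi T = phi A + phi B]; multiplying by some [X] that kills [B] gives an
    element with the same image as the product of [X] and [A], so injectivity
    yields an equation between [T] and [A]. The multipliers [E - F],
    ['i (E - F)], [E] and [F] separate the four corners. Inside the corner
    [E M F], additivity is read off the product of [E + A] and [F + B]; inside
    the diagonal it follows from the corners by multiplying with off-diagonal
    elements. That last step cancels a factor from products [F C E S] with [C]
    ranging over [M], which is where a factor must be known to be prime:
    [A M B = 0] implies [A = 0] or [B = 0].

    Primeness ([factor_prime]) reflects that a factor has no weakly closed
    ideals besides 0 and itself; the ideal at hand consists of the [D] in [M]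
    such that [A C D = A C D^* = 0] for all [C] in [M]. The orthogonal
    projection [E] onto the closed span of the ranges of its elements commutes
    with [M], because [M] is closed under adjoints and leaves this subspace
    invariant. It belongs to [M] because it is approximated on finitely many
    vectors by operators [1 - S], where [S] is a product of powers of
    contractions [1 - k D D^*]: these powers tend to 0 on the range of [D]
    ([shrink_exp_small]) and fix the orthogonal complement. So [E] is a scalar,
    and either [A] vanishes on the whole space or the ideal, which contains
    [B B^*], is zero.

    For multiplicativity, [phi] preserves adjoints and [S X + X S] for
    self-adjoint [S]. As ['i X + X 'i^* = 0], the image of ['i] is central,
    hence a scalar [l], and the products [('i S) X + X ('i S)^*] show that
    ['i (S X - X S)] goes to [l] times the commutator of the images. Comparing
    the two on a corner gives [l ^ 2 = -1] ([jmap_i_sqr]), which lets [l] be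
    cancelled: commutators are preserved as well, hence products. *)

(** * Real inner product and squared norm *)

Section Geometry.
Context {R : realType} {H : hilbertType R}.
Implicit Types (x y z w : H) (a : Cplx R) (s t e : R).

(** Typing the image of a real number in [Cplx R] rather than in [R[i]] keeps
    every scalar on a single path of algebraic structures, which rewriting
    depends on. *)
Definition rc t : Cplx R := (t%:C)%C.

Lemma rc_lt s t : (rc s < rc t) = (s < t).
Proof. exact: ltcR. Qed.

Lemma rc_le s t : (rc s <= rc t) = (s <= t).
Proof. exact: lecR. Qed.

Lemma rcM s t : rc (s * t) = rc s * rc t.
Proof. exact: (rmorphM (real_complex R)). Qed.

Lemma rcX t m : rc (t ^+ m) = rc t ^+ m.
Proof. exact: (rmorphXn (real_complex R)). Qed.

Lemma rc_gt0 t : 0 < t -> 0 < rc t.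
Proof. by rewrite -rc_lt. Qed.

Lemma gt0_rc a : 0 < a -> exists2 t : R, 0 < t & a = rc t.
Proof.
move=> a0; have aE : rc (complex.Re (a : R[i])) = a.
  exact: RRe_real (ger0_real (ltW a0)).
exists (complex.Re (a : R[i])); last by rewrite aE.
by rewrite -rc_lt aE.
Qed.

(** The estimates below only involve real numbers, so that [lra] applies to
    them; the complex-valued norm is recovered through [sqnE]. *)
Definition rdot x y : R := complex.Re (dotp x y : R[i]).
Definition sqn x : R := rdot x x.

Lemma Re_add (u v : Cplx R) : complex.Re (u + v) = complex.Re u + complex.Re v.
Proof. by case: u v => [? ?] []. Qed.

Lemma rdotC x y : rdot x y = rdot y x.
Proof. by rewrite /rdot dotpC; case: (dotp y x). Qed.

Lemma rdotDl x y z : rdot (x + y) z = rdot x z + rdot y z.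
Proof. by rewrite /rdot dotpDl Re_add. Qed.

Lemma rdotDr x y z : rdot z (x + y) = rdot z x + rdot z y.
Proof. by rewrite rdotC rdotDl !(rdotC z). Qed.

Lemma rdotNl x z : rdot (- x) z = - rdot x z.
Proof. by apply/eqP; rewrite -addr_eq0 -rdotDl addNr /rdot linear0l. Qed.

Lemma rdotNr x z : rdot z (- x) = - rdot z x.
Proof. by rewrite rdotC rdotNl (rdotC z). Qed.

Lemma rdotZr t x z : rdot z (rc t *: x) = t * rdot z x.
Proof.
rewrite rdotC (rdotC z) /rdot dotpZl.
by case: (dotp x z) => u v /=; rewrite mul0r subr0.
Qed.

Lemma rdotZl t x z : rdot (rc t *: x) z = t * rdot x z.
Proof. by rewrite rdotC rdotZr rdotC. Qed.

Lemma rdot_adj (A : 'B(H)) x y : rdot (A x) y = rdot x (adj A y).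
Proof. by rewrite /rdot adjP. Qed.

Lemma dotp_rdot0 x y : rdot x y = 0 -> rdot x ('i *: y) = 0 -> dotp x y = 0.
Proof.
rewrite /rdot dotpZr conjCi; case: (dotp x y) => u v /= ->.
by rewrite mulr0 sub0r mulN1r opprK => ->.
Qed.

Lemma sqnE x : `|x| ^+ 2 = rc (sqn x).
Proof.
rewrite dotp_norm; apply/esym.
have h : 0 <= dotp x x :> Cplx R by exact: dnorm_ge0.
exact: RRe_real (ger0_real h).
Qed.

Lemma sqn_ge0 x : 0 <= sqn x.
Proof. by rewrite -rc_le -sqnE; exact: exprn_ge0. Qed.

Lemma sqn_eq0 x : (sqn x == 0) = (x == 0).
Proof.
rewrite -(normr_eq0 x) -[RHS]sqrf_eq0 sqnE.
by apply/eqP/eqP => [->//|]; apply: complexI.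
Qed.

Lemma sqnD x y : sqn (x + y) = sqn x + sqn y + rdot x y *+ 2.
Proof. by rewrite /sqn rdotDl !rdotDr (rdotC y x); ring. Qed.

Lemma sqnN x : sqn (- x) = sqn x.
Proof. by rewrite /sqn rdotNl rdotNr opprK. Qed.

Lemma sqnB x y : sqn (x - y) = sqn x + sqn y - rdot x y *+ 2.
Proof. by rewrite sqnD sqnN rdotNr mulNrn. Qed.

Lemma sqn_distC x y : sqn (x - y) = sqn (y - x).
Proof. by rewrite -sqnN opprB. Qed.

Lemma sqnZ t x : sqn (rc t *: x) = t ^+ 2 * sqn x.
Proof. by rewrite /sqn rdotZl rdotZr mulrA expr2. Qed.

(** The triangle inequality for squared norms: the cross term is split by
    expanding the nonnegative number [sqn (t x - y) / t]. *)
Lemma sqnD_young t x y : 0 < t ->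
  sqn (x + y) <= (1 + t) * sqn x + (1 + t^-1) * sqn y.
Proof.
move=> t0; have := sqn_ge0 (rc t *: x - y).
rewrite sqnB sqnZ rdotZl sqnD => h.
have : 0 <= t^-1 * (t ^+ 2 * sqn x + sqn y - (t * rdot x y) *+ 2).
  by rewrite mulr_ge0// invr_ge0 ltW.
have -> : t^-1 * (t ^+ 2 * sqn x + sqn y - (t * rdot x y) *+ 2) =
  t * sqn x + t^-1 * sqn y - rdot x y *+ 2 by field; rewrite gt_eqF.
by lra.
Qed.

Lemma sqnD_le x y : sqn (x + y) <= sqn x *+ 2 + sqn y *+ 2.
Proof. by have := sqnD_young x y ltr01; rewrite invr1; lra. Qed.

Lemma ball_sqn x y e : 0 < e -> ball x (rc e) y <-> sqn (x - y) < e ^+ 2.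
Proof.
move=> e0; rewrite -ball_normE /ball_ /= -(@ltr_pXn2r _ 2%N) ?nnegrE//.
  by rewrite sqnE -rcX rc_lt.
exact/ltW/rc_gt0.
Qed.

Lemma dotp_sqn_lt x y e : 0 < e -> sqn x < e ^+ 2 / (sqn y + 1) ->
  `|dotp x y| < rc e.
Proof.
move=> e0 h; have y1 : 0 < sqn y + 1 by have := sqn_ge0 y; lra.
rewrite -(@ltr_pXn2r _ 2%N) ?nnegrE ?(ltW (rc_gt0 e0))//.
apply: (@le_lt_trans _ _ ((`|x| * `|y|) ^+ 2)).
  by rewrite ler_pXn2r ?nnegrE ?mulr_ge0// CauchySchwarz_dotp.
rewrite exprMn !sqnE -rcM -rcX rc_lt.
by move: h; rewrite ltr_pdivlMr//; have := sqn_ge0 x; lra.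
Qed.

Lemma bop_sqn_bounded (A : 'B(H)) :
  exists2 c : R, 0 < c & forall x, sqn (A x) <= c * sqn x.
Proof.
have [c c0 Ac] := bop_bounded A.
have [k k0 ck] : exists2 k : R, 0 < k & c + 1 = rc k.
  by apply: gt0_rc; rewrite ltr_wpDl.
exists (k ^+ 2); first exact: exprn_gt0.
move=> x; rewrite -rc_le rcM rcX -!sqnE -exprMn -ck.
rewrite ler_pXn2r ?nnegrE ?mulr_ge0 ?addr_ge0//.
by rewrite (le_trans (Ac x))// ler_wpM2r// lerDl.
Qed.

End Geometry.

(** * Orthogonal projection onto a closed subspace *)

Section Projection.
Context {R : realType} {H : hilbertType R}.
Implicit Types (x y z w : H) (a : Cplx R) (t e : R).

(** Completeness of [H] for nested families of sets whose diameters shrink. *)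
Lemma sqn_complete (S : R -> set H) :
  (forall e, 0 < e -> S e !=set0) ->
  (forall e e', e <= e' -> S e `<=` S e') ->
  (forall e x y, 0 < e -> S e x -> S e y -> sqn (x - y) < e) ->
  exists p, forall e x, 0 < e -> S e x -> sqn (p - x) <= e *+ 4.
Proof.
move=> S0 Smono Sdiam.
pose F := filter_from [set e : R | 0 < e] S.
have FF : ProperFilter F.
  apply: filter_from_proper; last by move=> e /S0.
  apply: filter_from_filter; first by exists 1 => /=.
  move=> e e' /= e0 e'0; exists (Num.min e e'); first by rewrite /= lt_min e0.
  by move=> x Sx; split; apply: Smono Sx; rewrite ge_min lexx ?orbT.
have cF : cvg F.
  apply/cauchy_cvgP/cauchy_ballP => // e /gt0_rc [k k0 ->].
  exists (S (k ^+ 2), S (k ^+ 2)).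
    by split; exists (k ^+ 2) => //=; exact: exprn_gt0.
  move=> [x y] [/= xk yk]; apply/ball_sqn => //.
  by apply: Sdiam => //; exact: exprn_gt0.
exists (lim F) => e x e0 Sx.
have k0 : 0 < Num.sqrt e by rewrite sqrtr_gt0.
have FB : F (ball (lim F) (rc (Num.sqrt e))).
  by apply: cF; apply: nbhsx_ballx; exact: rc_gt0.
have FS : F (S e) by exists e.
have [y [/= Sy /(ball_sqn _ _ k0)]] := filter_ex (filterI FS FB).
rewrite sqr_sqrtr ?(ltW e0)// => h.
have := sqnD_le (lim F - y) (y - x); rewrite addrA subrK.
by have := Sdiam _ _ _ e0 Sy Sx; lra.
Qed.

Definition closed_subspace (W : set H) := [/\ W 0,
  forall x y, W x -> W y -> W (x + y), forall a x, W x -> W (a *: x) &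
  forall x, (forall e, 0 < e -> exists2 w, W w & sqn (x - w) < e) -> W x].

Variable W : set H.
Hypothesis cW : closed_subspace W.

Let W0 : W 0. Proof. by case: cW. Qed.
Let WD x y : W x -> W y -> W (x + y). Proof. by case: cW => _ + _ _; apply. Qed.
Let WZ a x : W x -> W (a *: x). Proof. by case: cW => _ _ + _; apply. Qed.
Let WB x y : W x -> W y -> W (x - y).
Proof. by move=> Wx Wy; apply: WD => //; rewrite -scaleN1r; exact: WZ. Qed.
Let Wcl x : (forall e, 0 < e -> exists2 w, W w & sqn (x - w) < e) -> W x.
Proof. by case: cW => _ _ _; apply. Qed.

(** By the parallelogram law the points of [W] that nearly realise the distance
    to [x] are close to each other; their limit realises it. *)
Lemma nearest_point x :
  exists2 p, W p & forall w, W w -> sqn (x - p) <= sqn (x - w).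
Proof.
pose D := [set sqn (x - w) | w in W].
have Dlb : has_lbound D by exists 0 => _ [w _ <-]; exact: sqn_ge0.
pose m := inf D.
have mD w : W w -> m <= sqn (x - w) by move=> Ww; apply: ge_inf => //; exists w.
have D0 : D !=set0 by exists (sqn (x - 0)); exists 0 => //; exact: W0.
have m0 : 0 <= m by apply: lb_le_inf => // _ [w _ <-]; exact: sqn_ge0.
pose S e := [set w | W w /\ sqn (x - w) < m + e / 4].
have S0 e : 0 < e -> S e !=set0.
  move=> e0; have e4 : 0 < e / 4 by rewrite divr_gt0.
  by have [|_ [w Ww <-] we] := @inf_adherent _ D _ e4; [by split|exists w].
have Smono e e' : e <= e' -> S e `<=` S e'.
  by move=> ee' w [Ww h]; split=> //; lra.
have Sdiam e y z : 0 < e -> S e y -> S e z -> sqn (y - z) < e.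
  move=> e0 [Wy ye] [Wz ze].
  have := mD _ (WZ (rc 2^-1) (WD Wy Wz)).
  have -> : x - rc 2^-1 *: (y + z) = rc 2^-1 *: ((x - y) + (x - z)).
    rewrite !scalerDr !scalerN addrACA -opprD -scalerDl -scalerDr.
    have -> : rc 2^-1 + rc 2^-1 = 1 :> Cplx R.
      have h : 2^-1 + 2^-1 = 1 :> R by field.
      exact: etrans (esym (rmorphD (real_complex R) _ _)) (congr1 _ h).
    by rewrite scale1r.
  rewrite sqnZ sqnD.
  have -> : y - z = (x - z) - (x - y) by rewrite opprB [RHS]addrC addrA subrK.
  by rewrite (sqnB (x - z)) (rdotC (x - z)); lra.
have [p pS] := sqn_complete S0 Smono Sdiam.
have Wp : W p.
  apply: Wcl => e e0; have [|w Sw] := S0 (e / 5); first by lra.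
  by exists w; [case: Sw|have := pS _ _ _ Sw; lra].
exists p => // w /mD; apply: le_trans; rewrite leNgt; apply/negP => lt.
pose d := sqn (x - p) - m.
have d0 : 0 < d by rewrite subr_gt0.
(* A point of [S (t * t)] and [sqnD_young] at [t] give [d <= t * (m + 9)] as
   soon as [t < 1]; this [t] is chosen so that [t * (d + m + 10) = d]. *)
pose t := d / (d + m + 10).
have dm : 0 < d + m + 10 by lra.
have t0 : 0 < t by rewrite divr_gt0.
have tE : t * (d + m + 10) = d by rewrite divfK// gt_eqF.
have t1 : t < 1 by rewrite ltr_pdivrMr// mul1r; lra.
have tt0 : 0 < t * t by rewrite mulr_gt0.
have [v Sv] := S0 _ tt0.
have h1 := pS _ _ tt0 Sv; case: Sv => Wv h2.
have := sqnD_young (x - v) (v - p) t0; rewrite addrA subrK.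
rewrite (sqn_distC v).
have h3 : t^-1 * sqn (p - v) <= t *+ 4.
  rewrite -(@ler_pM2l _ t)// mulrA divff ?gt_eqF// mul1r.
  by apply: (le_trans h1); lra.
have h4 : t * t < t by rewrite -[ltRHS]mulr1 ltr_pM2l.
have h5 : t * sqn (x - v) <= t * (m + 1).
  by rewrite ler_pM2l//; lra.
have h6 : 0 <= t * d by rewrite mulr_ge0// ltW.
by move: tE; rewrite /d in h6 *; lra.
Qed.

(** Moving [p] along [w] by the step that would shorten [x - p] must not
    shorten it. *)
Lemma orthogonal_projection x :
  exists2 p, W p & forall w, W w -> dotp (x - p) w = 0.
Proof.
have [p Wp pmin] := nearest_point x; exists p => // w Ww.
suff h v : W v -> rdot (x - p) v = 0.
  by apply: dotp_rdot0; apply: h => //; exact: WZ.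
move=> Wv; set r := rdot _ _.
(* the optimal step is [r / sqn v]; adding 1 avoids the case [v = 0] *)
pose s := (sqn v + 1)^-1.
have v0 := sqn_ge0 v; have s0 : 0 < s by rewrite invr_gt0; lra.
have sv : s * (sqn v + 1) = 1 by rewrite mulVf// gt_eqF//; lra.
have := pmin _ (WD Wp (WZ (rc (r * s)) Wv)).
rewrite opprD addrA [leRHS]sqnB rdotZr sqnZ -/r.
have -> : (r * s) ^+ 2 * sqn v = r ^+ 2 * s * (s * sqn v) by ring.
have -> : s * sqn v = 1 - s by lra.
have r2 : 0 <= r ^+ 2 * s by rewrite mulr_ge0 ?sqr_ge0// ltW.
have r3 : 0 <= r ^+ 2 * s * s by rewrite mulr_ge0// ltW.
move=> h; have : r ^+ 2 * s = 0 by lra.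
by move/eqP; rewrite mulf_eq0 (gt_eqF s0) orbF sqrf_eq0 => /eqP.
Qed.

Lemma orthogonal_projection_unique x p q :
  W p -> (forall w, W w -> dotp (x - p) w = 0) ->
  W q -> (forall w, W w -> dotp (x - q) w = 0) -> p = q.
Proof.
move=> Wp op Wq oq; apply/eqP; rewrite -subr_eq0 -sqn_eq0 /sqn /rdot.
have Wd : W (p - q) by exact: WB.
have -> : dotp (p - q) (p - q) = 0; last by [].
have {1}-> : p - q = (x - q) - (x - p) by rewrite opprB [RHS]addrC addrA subrK.
by rewrite dotpBl op// oq// subrr.
Qed.

Lemma projection_operator : exists E : 'B(H),
  forall x, W (E x) /\ forall w, W w -> dotp (x - E x) w = 0.
Proof.
have /choice[f fP] x : exists p, W p /\ forall w, W w -> dotp (x - p) w = 0.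
  by have [p Wp px] := orthogonal_projection x; exists p.
have uniq x p : W p -> (forall w, W w -> dotp (x - p) w = 0) -> f x = p.
  move=> Wp op; have [Wf orth_f] := fP x.
  exact: (orthogonal_projection_unique Wf orth_f Wp op).
have fD : {morph f : x y / x + y}.
  move=> x y; have [[Wx ox] [Wy oy]] := (fP x, fP y).
  apply: uniq; first exact: WD.
  by move=> w Ww; rewrite opprD addrACA dotpDl ox// oy// addr0.
have fZ a : {morph f : x / a *: x}.
  move=> x; have [Wx ox] := fP x; apply: uniq; first exact: WZ.
  by move=> w Ww; rewrite -scalerBr dotpZl ox// mulr0.
have fc x : `|f x| <= 1 * `|x|.
  have [Wx ox] := fP x.
  rewrite mul1r -(@ler_pXn2r _ 2%N) ?nnegrE// !sqnE rc_le.
  rewrite -{2}(subrK (f x) x) sqnD /rdot ox// mul0rn addr0 lerDr.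
  exact: sqn_ge0.
by exists (mk_bop fD fZ ler01 fc).
Qed.

End Projection.

(** * Approximation in the weak operator topology *)

Lemma cvg_initial (S : choiceType) (T : topologicalType) (f : S -> T)
    (F : set_system S) (s : S) : Filter F ->
  f @ F --> f s -> F --> (s : initial_topology f).
Proof.
move=> FF fF B; rewrite nbhsE => -[_ [[A oA <-] As] AB].
by apply: filterS AB _; apply: fF; exact: open_nbhs_nbhs.
Qed.

(** Strong approximation on finitely many vectors at a time defines a filter
    that converges weakly to [E]. *)
Lemma wot_closed_approx (R : realType) (H : hilbertType R) (M : set 'B(H))
    (E : 'B(H)) :
  closed (M : set (wot H)) ->
  (forall (s : seq H) (e : R), 0 < e ->
    exists2 A, M A & {in s, forall x, sqn (A x - E x) < e}) -> M E.
Proof.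
move=> Mcl app.
pose F : set_system 'B(H) := filter_from [set p : seq H * R | 0 < p.2]
  (fun p => [set A | M A /\ {in p.1, forall x, sqn (A x - E x) < p.2}]).
have FF : ProperFilter F.
  apply: filter_from_proper; last first.
    by move=> [s e] /= e0; have [A MA Ae] := app s e e0; exists A.
  apply: filter_from_filter; first by exists ([::], 1) => /=.
  move=> [s e] [t e'] /= e0 e'0.
  exists (s ++ t, Num.min e e'); first by rewrite /= lt_min e0.
  move=> A [MA h]; split; split=> //= x xs.
    by have := h x; rewrite /= mem_cat xs lt_min => /(_ isT)/andP[].
  by have := h x; rewrite /= mem_cat xs orbT lt_min => /(_ isT)/andP[].
have FE : F --> (E : wot H).
  apply: cvg_initial; apply/cvg_sup => -[x y]; apply: cvg_initial.
  apply/cvgrPdist_lt => _ /gt0_rc[e e0 ->].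
  have y1 : 0 < sqn y + 1 by have := sqn_ge0 y; lra.
  exists ([:: x], e ^+ 2 / (sqn y + 1)) => /=.
    by rewrite divr_gt0// exprn_gt0.
  move=> A [_ /(_ x)]; rewrite inE eqxx => /(_ isT) h.
  by rewrite /= /proj /= -dotpBl; apply: dotp_sqn_lt => //; rewrite sqn_distC.
apply: Mcl => B /FE FB; have FM : F M by exists ([::], 1) => //= A [].
exact: (filter_ex (filterI FM FB)).
Qed.

(** * Algebra of the *-Jordan product *)

Section OperatorAlgebra.
Context {R : realType} {H : hilbertType R}.
Implicit Types (A B X Y : 'B(H)) (a : Cplx R).

Lemma bop_scalerAl a A B : a *: (A * B) = (a *: A) * B.
Proof. exact: bopP. Qed.

Lemma bop_scalerAr a A B : a *: (A * B) = A * (a *: B).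
Proof. by apply: bopP => x; rewrite bopZE !bopME bopZE linearZ. Qed.

Lemma adj0 : adj 0 = 0 :> 'B(H).
Proof. by apply: (addrI (adj 0)); rewrite -adjD !addr0. Qed.

Lemma adjN A : adj (- A) = - adj A.
Proof. by apply/eqP; rewrite -addr_eq0 -adjD addNr adj0. Qed.

Lemma adjB A B : adj (A - B) = adj A - adj B.
Proof. by rewrite adjD adjN. Qed.

Lemma bop_dbl A : A + A = 2%:R *: A.
Proof. by rewrite scaler_nat mulr2n. Qed.

Lemma bop_dbl_inj A B : A + A = B + B -> A = B.
Proof. by rewrite !bop_dbl => /(scalerI _); apply; rewrite pnatr_eq0. Qed.

Lemma bop_dbl_eq0 A : A + A = 0 -> A = 0.
Proof. by move=> AA; apply: bop_dbl_inj; rewrite AA addr0. Qed.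

Lemma sjordanDl X A B : sjordan (A + B) X = sjordan A X + sjordan B X.
Proof. by rewrite /sjordan adjD mulrDl mulrDr addrACA. Qed.

Lemma sjordanDr X A B : sjordan X (A + B) = sjordan X A + sjordan X B.
Proof. by rewrite /sjordan mulrDl mulrDr addrACA. Qed.

Lemma sjordanBr X A B : sjordan X (A - B) = sjordan X A - sjordan X B.
Proof. by rewrite /sjordan mulrBl mulrBr opprD addrACA. Qed.

Lemma sjordan0l X : sjordan 0 X = 0.
Proof. by rewrite /sjordan adj0 mul0r mulr0 addr0. Qed.

Lemma sjordan1l X : sjordan 1 X = X + X.
Proof. by rewrite /sjordan Defs.adj1 mul1r mulr1. Qed.

Lemma sjordan1r X : sjordan X 1 = X + adj X.
Proof. by rewrite /sjordan mulr1 mul1r. Qed.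

Lemma sjordanZl a X A :
  Num.conj a = a -> sjordan (a *: X) A = a *: sjordan X A.
Proof.
move=> ca; rewrite /sjordan Defs.adjZ ca.
by rewrite -bop_scalerAl -bop_scalerAr scalerDr.
Qed.

(** The normalisation of the product for which [1] is a left unit. *)
Definition hjordan A B := 2%:R^-1 *: sjordan A B.

Lemma hjordanDl X A B : hjordan (A + B) X = hjordan A X + hjordan B X.
Proof. by rewrite /hjordan sjordanDl scalerDr. Qed.

Lemma hjordanDr X A B : hjordan X (A + B) = hjordan X A + hjordan X B.
Proof. by rewrite /hjordan sjordanDr scalerDr. Qed.

Lemma hjordan_inj A B X Y :
  hjordan A X = hjordan B Y -> sjordan A X = sjordan B Y.
Proof. by apply: scalerI; rewrite invr_eq0 pnatr_eq0. Qed.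

Lemma bop_half A : 2%:R^-1 *: A + 2%:R^-1 *: A = A.
Proof. by rewrite bop_dbl scalerA mulfV ?scale1r// pnatr_eq0. Qed.

Lemma hjordan_dbl A B : hjordan A B + hjordan A B = sjordan A B.
Proof. exact: bop_half. Qed.

Lemma conj_pow2 m : Num.conj ((2%:R : Cplx R) ^+ m) = 2%:R ^+ m.
Proof. by rewrite rmorphXn rmorph_nat. Qed.

(** A leading entry 1 only doubles the product, since [sjordan 1 X = X + X]. *)
Lemma sjordan_seq_ones m A B :
  sjordan_seq (nseq m 1 ++ [:: A; B]) = (2%:R : Cplx R) ^+ m *: sjordan A B.
Proof.
case: m => [|m]; first by rewrite expr0 scale1r.
rewrite /= foldl_cat /=.
have -> : foldl sjordan 1 (nseq m 1) =
    (2%:R : Cplx R) ^+ m *: (1 : 'B(H)).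
  elim: m => [|m IH]; first by rewrite expr0 scale1r.
  rewrite -addn1 nseqD foldl_cat IH /= sjordanZl ?conj_pow2// sjordan1l.
  by rewrite bop_dbl scalerA addn1 exprSr.
rewrite sjordanZl ?conj_pow2// sjordan1l bop_dbl scalerA -exprSr.
by rewrite sjordanZl ?conj_pow2.
Qed.

End OperatorAlgebra.

Section Membership.
Context {R : realType} {H : hilbertType R}.
Implicit Types (A B : 'B(H)) (M : set 'B(H)).

Lemma vNaN M A : von_neumann_algebra M -> M A -> M (- A).
Proof. by move=> vM MA; rewrite -scaleN1r; exact: vNaZ. Qed.

Lemma vNaB M A B : von_neumann_algebra M -> M A -> M B -> M (A - B).
Proof. by move=> vM MA MB; apply: vNaD => //; exact: vNaN. Qed.

Lemma vNa0 M : von_neumann_algebra M -> M 0.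
Proof. by move=> vM; rewrite -(subrr 1); apply: vNaB => //; exact: vNa1. Qed.

Lemma vNa_sjordan M A B :
  von_neumann_algebra M -> M A -> M B -> M (sjordan A B).
Proof.
by move=> vM MA MB; apply: vNaD => //; apply: vNaM => //; apply: vNa_adj.
Qed.

Lemma vNa_hjordan M A B :
  von_neumann_algebra M -> M A -> M B -> M (hjordan A B).
Proof. by move=> vM MA MB; apply: vNaZ => //; exact: vNa_sjordan. Qed.

End Membership.

Ltac vNa_mem := repeat first
  [ assumption | apply: vNa_hjordan => // | apply: vNa_sjordan => //
  | apply: vNaB => // | apply: vNaD => // | apply: vNaM => //
  | apply: vNa_adj => // | apply: vNaZ => // | apply: vNaN => //
  | apply: vNa1 | apply: vNa0 ].

(** * Factors are prime *)

Section Shrinking.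
Context {R : realType} {H : hilbertType R}.
Implicit Types (x y z w : H) (A B C D E : 'B(H)) (k e c : R).

Definition contraction C := forall x, sqn (C x) <= sqn x.

Lemma contraction1 : contraction 1.
Proof. by move=> x. Qed.

Lemma contractionM A B : contraction A -> contraction B -> contraction (A * B).
Proof. by move=> cA cB x; apply: le_trans (cA _) (cB _). Qed.

Definition shrink k D : 'B(H) := 1 - rc k *: (adj D * D).

Lemma sqn_shrink k c D : 0 < k -> k * c <= 1 ->
  (forall x, sqn (adj D x) <= c * sqn x) ->
  forall x, sqn (shrink k D x) + k * sqn (D x) <= sqn x.
Proof.
move=> k0 kc Dc x.
have -> : shrink k D x = x - rc k *: adj D (D x) by [].
rewrite sqnB sqnZ rdotZr -{2}(adjK D) -rdot_adj -/(sqn _).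
have D0 := sqn_ge0 (D x).
have : k * (k * sqn (adj D (D x))) <= k * (k * (c * sqn (D x))).
  by rewrite !ler_pM2l.
have : k * ((k * c) * sqn (D x)) <= k * (1 * sqn (D x)).
  by rewrite ler_pM2l// ler_wpM2r.
rewrite adjK; lra.
Qed.

Lemma shrink_comm k D : D * shrink k D = shrink k (adj D) * D.
Proof.
rewrite /shrink adjK mulrBr mulrBl mulr1 mul1r.
by rewrite -bop_scalerAr -bop_scalerAl mulrA.
Qed.

Lemma shrink_exp_comm k D m : D * shrink k D ^+ m = shrink k (adj D) ^+ m * D.
Proof.
elim: m => [|m IH]; first by rewrite !expr0 mul1r mulr1.
by rewrite exprSr mulrA IH -mulrA shrink_comm mulrA -exprSr.
Qed.

(** Each application of [shrink k D] to [z] lowers the squared norm by at least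
    [k * sqn (D z)]. By [shrink_comm] these losses decrease along the iteration,
    so [m] times the last one is at most [sqn x]. *)
Lemma sqn_shrink_exp k c D : 0 < k -> k * c <= 1 ->
  (forall x, sqn (D x) <= c * sqn x) ->
  (forall x, sqn (adj D x) <= c * sqn x) ->
  forall m x, sqn ((shrink k D ^+ m) x) +
    m%:R * (k * sqn (D ((shrink k D ^+ m) x))) <= sqn x.
Proof.
move=> k0 kc Dc Dc' m x; elim: m => [|m IH].
  by rewrite expr0 mul0r addr0.
have := sqn_shrink k0 kc Dc' ((shrink k D ^+ m) x).
set y := (shrink k D ^+ m) x in IH *.
have -> : (shrink k D ^+ m.+1) x = shrink k D y by rewrite exprS.
have Dle : sqn (D (shrink k D y)) <= sqn (D y).
  have -> : D (shrink k D y) = shrink k (adj D) (D y).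
    by rewrite -!bopME shrink_comm.
  have := @sqn_shrink k c (adj D) k0 kc; rewrite adjK => /(_ Dc (D y)).
  have := sqn_ge0 (adj D (D y)) => h.
  have := mulr_ge0 (ltW k0) h; lra.
have : m.+1%:R * (k * sqn (D (shrink k D y))) <= m.+1%:R * (k * sqn (D y)).
  by rewrite ler_wpM2l// ler_pM2l.
rewrite -[in leRHS]natr1; lra.
Qed.

(** [1 - k D D^*] raised to a large power is small on the range of [D]: moving
    [D] to the left through the power turns it into the quantity that
    [sqn_shrink_exp] controls. *)
Lemma shrink_exp_small D y e : 0 < e ->
  exists k m, [/\ contraction (shrink k (adj D)) &
    sqn ((shrink k (adj D) ^+ m) (D y)) < e].
Proof.
move=> e0; have [c c0 Dc] := bop_sqn_bounded D.
have [c' c'0 Dc'] := bop_sqn_bounded (adj D).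
have Dcc x : sqn (D x) <= (c + c') * sqn x.
  by apply: (le_trans (Dc x)); rewrite ler_wpM2r ?sqn_ge0//; lra.
have Dcc' x : sqn (adj D x) <= (c + c') * sqn x.
  by apply: (le_trans (Dc' x)); rewrite ler_wpM2r ?sqn_ge0//; lra.
have cc0 : 0 < c + c' by lra.
pose k := (c + c')^-1.
have k0 : 0 < k by rewrite invr_gt0.
have kc : k * (c + c') = 1 by rewrite mulVf// gt_eqF.
have kc1 : k * (c + c') <= 1 by rewrite kc.
have ke0 : 0 < k * e by rewrite mulr_gt0.
pose b := sqn y / (k * e).
have b0 : 0 <= b by rewrite divr_ge0 ?sqn_ge0// ltW.
have bE : b * (k * e) = sqn y by rewrite divfK// gt_eqF.
exists k, (Num.bound b); split.
  move=> x; have := @sqn_shrink k (c + c') (adj D) k0 kc1.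
  rewrite adjK => /(_ Dcc x).
  by have := mulr_ge0 (ltW k0) (sqn_ge0 (adj D x)); lra.
rewrite -bopME -shrink_exp_comm bopME.
have := sqn_shrink_exp k0 kc1 Dcc Dcc' (Num.bound b) y.
set v := (shrink k D ^+ _) y; have := sqn_ge0 v.
have bm : b < (Num.bound b)%:R by exact: archi_boundP.
move=> v0 h; rewrite ltNge; apply/negP => eD.
have m0 : 0 < (Num.bound b)%:R :> R by exact: le_lt_trans bm.
have : (Num.bound b)%:R * (k * e) <= (Num.bound b)%:R * (k * sqn (D v)).
  by rewrite ler_pM2l// ler_pM2l.
have : b * (k * e) < (Num.bound b)%:R * (k * e) by rewrite ltr_pM2r.
by rewrite bE; lra.
Qed.

End Shrinking.

Section Prime.
Context {R : realType} {H : hilbertType R} (M : set 'B(H)).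
Hypothesis vM : von_neumann_algebra M.
Variable A : 'B(H).
Hypothesis MA : M A.
Implicit Types (x y z w : H) (B C D E S T : 'B(H)) (e : R).

(** The condition on [adj D] makes this two-sided ideal of [M] self-adjoint. *)
Definition annihilated D :=
  M D /\ forall C, M C -> A * C * D = 0 /\ A * C * adj D = 0.

Lemma annihilated0 : annihilated 0.
Proof. by split=> [|C _]; [exact: vNa0|rewrite adj0 !mulr0]. Qed.

Lemma annihilated_adj D : annihilated D -> annihilated (adj D).
Proof.
move=> [MD h]; split=> [|C /h[h1 h2]]; first exact: vNa_adj.
by rewrite adjK.
Qed.

Lemma annihilatedD D E : annihilated D -> annihilated E -> annihilated (D + E).
Proof.
move=> [MD hD] [ME hE]; split=> [|C MC]; first exact: vNaD.
have [h1 h2] := hD C MC; have [h3 h4] := hE C MC.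
by rewrite adjD !mulrDr h1 h2 h3 h4 addr0.
Qed.

Lemma annihilatedMl C D : M C -> annihilated D -> annihilated (C * D).
Proof.
move=> MC [MD hD]; split=> [|C' MC']; first exact: vNaM.
have [h1 _] := hD (C' * C) (vNaM vM MC' MC); have [_ h2] := hD C' MC'.
by rewrite adjM !mulrA h2 mul0r -[A * _ * _]mulrA h1.
Qed.

Lemma annihilatedMr C D : M C -> annihilated D -> annihilated (D * C).
Proof.
move=> MC aD; rewrite -[D * C]adjK adjM; apply/annihilated_adj/annihilatedMl.
  exact: vNa_adj.
exact: annihilated_adj.
Qed.

(** Dampers are stable under products, so that vectors can be made small one
    after the other. *)
Definition damper S := [/\ M S, annihilated (1 - S) & contraction S].

Lemma damper1 : damper 1.
Proof.
split; [exact: vNa1| rewrite subrr; exact: annihilated0|exact: contraction1].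
Qed.

Lemma damperM S T : damper S -> damper T -> damper (S * T).
Proof.
move=> [MS aS cS] [MT aT cT]; split; [exact: vNaM| |exact: contractionM].
have -> : 1 - S * T = (1 - S) * T + (1 - T).
  by rewrite mulrBl mul1r [RHS]addrC addrA subrK.
by apply: annihilatedD => //; exact: annihilatedMr.
Qed.

Lemma damperX S m : damper S -> damper (S ^+ m).
Proof.
move=> dS; elim: m => [|m IH]; first by rewrite expr0; exact: damper1.
by rewrite exprS; exact: damperM.
Qed.

Lemma damper_shrink k D : annihilated D -> contraction (shrink k D) ->
  damper (shrink k D).
Proof.
move=> aD cD; have MD : M D := aD.1.
have MDD : M (adj D * D) by apply: vNaM => //; exact: vNa_adj.
split => //; first by apply: vNaB => //; [exact: vNa1|exact: vNaZ].
rewrite /shrink opprB addrC subrK.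
rewrite bop_scalerAl; apply: annihilatedMl => //.
by apply: vNaZ => //; exact: vNa_adj.
Qed.

(** The closed span of the ranges of the annihilated operators. The quantifier
    on [C] makes the set invariant under [M] by definition; it also makes it a
    subspace, because a damper [S] that makes [C x] small sends [C y] to
    [(S * C) y], which can be made small in turn. *)
Definition damped w :=
  forall C e, M C -> 0 < e -> exists2 S, damper S & sqn (S (C w)) < e.

Lemma damped_annihilated D y : annihilated D -> damped (D y).
Proof.
move=> aD C e MC e0; have aCD := annihilatedMl MC aD.
have [k [m [cS h]]] := shrink_exp_small (C * D) y e0.
exists (shrink k (adj (C * D)) ^+ m); last exact: h.
by apply/damperX/damper_shrink => //; exact: annihilated_adj.
Qed.

Lemma damped_bop C w : M C -> damped w -> damped (C w).
Proof. by move=> MC dw C' e MC' e0; exact: (dw _ _ (vNaM vM MC' MC) e0). Qed.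

Lemma damped_closed : closed_subspace damped.
Proof.
split.
- move=> C e MC e0; exists 1; first exact: damper1.
  rewrite bop1E linear0; suff -> : sqn (0 : H) = 0 by [].
  by apply/eqP; rewrite sqn_eq0.
- move=> x y dx dy C e MC e0; have e4 : 0 < e / 4 by lra.
  have [S dS Sx] := dx C _ MC e4; have MS : M S by case: dS.
  have [T dT Ty] := dy (S * C) _ (vNaM vM MS MC) e4.
  exists (T * S); first exact: damperM.
  rewrite bopME !linearD /=; rewrite bopME in Ty.
  have := sqnD_le (T (S (C x))) (T (S (C y))).
  have : sqn (T (S (C x))) <= sqn (S (C x)) by case: dT.
  by lra.
- move=> a x dx C e MC e0.
  have [S dS h] := dx (a *: C) _ (vNaZ vM _ MC) e0; exists S => //.
  by rewrite linearZ.
- move=> x dx C e MC e0; have [c c0 Cc] := bop_sqn_bounded C.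
  have c4 : 0 < e / (4 * c) by rewrite divr_gt0// mulr_gt0.
  have [w dw xw] := dx _ c4; have e4 : 0 < e / 4 by lra.
  have [S dS Sw] := dw C _ MC e4; exists S => //.
  have := sqnD_le (S (C (x - w))) (S (C w)).
  rewrite -linearD -linearD /= subrK.
  have : sqn (S (C (x - w))) <= sqn (C (x - w)) by case: dS.
  have : c * sqn (x - w) < e / 4.
    by move: xw; rewrite invfM mulrA ltr_pdivlMr// mulrC.
  by have := Cc (x - w); lra.
Qed.

Lemma damped_common (s : seq H) e : 0 < e -> {in s, forall x, damped x} ->
  exists2 S, damper S & {in s, forall x, sqn (S x) < e}.
Proof.
move=> e0; elim: s => [|x s IH] ds; first by exists 1 => //; exact: damper1.
have [|S dS Ss] := IH; first by move=> y ys; apply: ds; rewrite inE ys orbT.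
have [T dT Tx] : exists2 T, damper T & sqn (T (S x)) < e.
  by apply: ds => //; [rewrite mem_head|case: dS].
exists (T * S); first exact: damperM.
move=> y; rewrite inE => /orP[/eqP ->|ys]; first exact: Tx.
by apply: le_lt_trans (Ss _ ys); rewrite bopME; case: dT.
Qed.

Lemma annihilated_orthogonal D x : annihilated D ->
  (forall w, damped w -> dotp x w = 0) -> D x = 0.
Proof.
move=> aD ox; apply/eqP; rewrite -sqn_eq0 /sqn rdot_adj /rdot ox//.
by apply: damped_annihilated; exact: annihilated_adj.
Qed.

Lemma damped_annul w : damped w -> A w = 0.
Proof.
move=> dw; have [c c0 Ac] := bop_sqn_bounded A.
apply/eqP; rewrite -sqn_eq0 eq_le sqn_ge0 andbT.
apply/ler_addgt0Pr => e e0; rewrite add0r.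
have ec : 0 < e / c by rewrite divr_gt0.
have [S [MS [_ aS] _]] := dw 1 _ (vNa1 vM) ec; rewrite bop1E => h.
have -> : A w = A (S w).
  have [+ _] := aS 1 (vNa1 vM).
  rewrite mulr1 mulrBr mulr1 => /eqP; rewrite subr_eq0 => /eqP AS.
  by rewrite -bopME -AS.
by apply: le_trans (Ac _) _; move: h; rewrite ltr_pdivlMr// mulrC => /ltW.
Qed.

(** On finitely many vectors [x] the projection [E] is approximated by [1 - S],
    where the damper [S] makes all the [E x] small: it fixes the vectors
    [x - E x], which [annihilated_orthogonal] shows [1 - S] to kill. *)
Lemma damped_projection : exists E, [/\ M E, forall C, M C -> E * C = C * E,
  forall x, damped (E x) & forall w, damped w -> E w = w].
Proof.
have [E EP] := projection_operator damped_closed.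
have uniq x p :
    damped p -> (forall w, damped w -> dotp (x - p) w = 0) -> E x = p.
  move=> dp op; have [dE oE] := EP x.
  exact: (orthogonal_projection_unique damped_closed dE oE dp op).
exists E; split.
- apply: (wot_closed_approx (vNa_closed vM)) => s e e0.
  have [|S dS Ss] := @damped_common (map E s) e e0.
    by move=> _ /mapP[x _ ->]; case: (EP x).
  case: (dS) => MS aS _; exists (1 - S).
    by apply: vNaB => //; exact: vNa1.
  move=> x xs; have := Ss (E x); rewrite map_f// => /(_ isT).
  have := annihilated_orthogonal aS (EP x).2.
  rewrite bopDE bopNE bop1E linearB /= => /eqP.
  rewrite subr_eq0 => /eqP h.
  have -> : (1 - S) x - E x = - S (E x).
    by rewrite bopDE bopNE bop1E addrAC h addrAC subrr sub0r.
  by rewrite sqnN.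
- move=> C MC; apply: bopP => x; rewrite !bopME; have [dE oE] := EP x.
  apply: uniq; first exact: damped_bop.
  move=> w dw; rewrite -linearB /= adjP oE//; apply: damped_bop => //.
  exact: vNa_adj.
- by move=> x; case: (EP x).
- by move=> w dw; apply: uniq => // w' _; rewrite subrr linear0l.
Qed.

End Prime.

Definition prime_algebra (R : realType) (H : hilbertType R) (M : set 'B(H)) :=
  forall A B, M A -> M B -> (forall C, M C -> A * C * B = 0) -> A = 0 \/ B = 0.

(** The projection onto the damped vectors is a scalar. If it is nonzero, every
    vector is damped, hence killed by [A]; if it is zero, the annihilated
    operator [B B^*] has zero range. *)
Theorem factor_prime (R : realType) (H : hilbertType R) (M : set 'B(H)) :
  vN_factor M -> prime_algebra M.
Proof.
move=> [vM cM] A B MA MB ACB.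
have [E [ME EC dE Ew]] := damped_projection vM A.
have [a _ aE] := cM E (conj ME EC).
have [a0|a0] := eqVneq a 0; [right|left].
  have aBB : annihilated M A (B * adj B).
    split=> [|C MC]; first by apply: vNaM => //; exact: vNa_adj.
    by rewrite adjM adjK mulrA ACB// mul0r.
  suff B0 : adj B = 0 by rewrite -[B]adjK B0 adj0.
  apply: bopP => y; apply/eqP; rewrite bop0E -sqn_eq0 /sqn rdot_adj adjK.
  have := Ew _ (damped_annihilated vM y aBB).
  rewrite -aE a0 scale0r bop0E bopME => <-.
  by rewrite rdotC /rdot linear0l.
apply: bopP => x; rewrite bop0E.
have -> : x = E (a^-1 *: x).
  by rewrite -aE bopZE bop1E scalerA divff// scale1r.
exact: (damped_annul vM).
Qed.
(** * Peirce decomposition *)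

Section Peirce.
Context {R : realType} {H : hilbertType R}.
Implicit Types (A B X Y E F : 'B(H)).

Record complementary E F : Prop := {
  cpl_adjl : adj E = E; cpl_adjr : adj F = F;
  cpl_idl : E * E = E; cpl_idr : F * F = F;
  cpl_lr : E * F = 0; cpl_rl : F * E = 0;
  cpl_add : E + F = 1 }.

Lemma complementaryC E F : complementary E F -> complementary F E.
Proof. by case=> *; split => //; rewrite addrC. Qed.

Lemma projection_complementary P : is_projection P -> complementary P (1 - P).
Proof.
move=> [Pa PP]; split; rewrite ?adjB ?Defs.adj1 ?Pa//.
- by rewrite mulrBl mul1r mulrBr mulr1 PP subrr subr0.
- by rewrite mulrBr mulr1 PP subrr.
- by rewrite mulrBl mul1r PP subrr.
- by rewrite addrC subrK.
Qed.

Definition corner E F X := E * X = X /\ X * F = X.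

Lemma corner_adj E F X :
  complementary E F -> corner E F X -> corner F E (adj X).
Proof.
move=> c [EX XF]; split.
  by rewrite -{1}(cpl_adjr c) -adjM XF.
by rewrite -{1}(cpl_adjl c) -adjM EX.
Qed.

Lemma corner_add E F X Y : corner E F X -> corner E F Y -> corner E F (X + Y).
Proof.
by move=> [? ?] [? ?]; split; rewrite ?mulrDl ?mulrDr; congr (_ + _).
Qed.

Lemma corner_scale E F X (a : Cplx R) : corner E F X -> corner E F (a *: X).
Proof.
by move=> [EX XF]; split; rewrite -?bop_scalerAr -?bop_scalerAl ?EX ?XF.
Qed.

Lemma corner_mul E F G X Y : corner E F X -> corner F G Y -> corner E G (X * Y).
Proof. by move=> [EX _] [_ YG]; split; rewrite ?mulrA ?EX -?mulrA ?YG. Qed.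

Lemma corner_mid E F X : E * E = E -> F * F = F -> corner E F (E * X * F).
Proof. by move=> EE FF; split; rewrite ?mulrA ?EE // -mulrA FF. Qed.

Lemma corner_l0 E F G X : corner E F X -> G * E = 0 -> G * X = 0.
Proof. by move=> [<- _] GE; rewrite mulrA GE mul0r. Qed.

Lemma corner_r0 E F G X : corner E F X -> F * G = 0 -> X * G = 0.
Proof. by move=> [_ <-] FG; rewrite -mulrA FG mulr0. Qed.

Lemma corner_mul0 E F G K X Y : corner E F X -> corner G K Y -> F * G = 0 ->
  X * Y = 0.
Proof. by move=> [_ <-] cY FG; rewrite -mulrA (corner_l0 cY FG) mulr0. Qed.

Lemma peirce_decomp E F X : E + F = 1 ->
  X = (E * X * E + F * X * F) + (E * X * F + F * X * E).
Proof.
move=> EF; rewrite addrACA -!mulrDr [F + E]addrC EF !mulr1 -mulrDl EF.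
by rewrite mul1r.
Qed.

(** The diagonal and off-diagonal parts of the Peirce decomposition are the
    eigenspaces of conjugation by the symmetry [E - F]. *)
Definition peirce_diag E F X := (E - F) * X = X * (E - F).
Definition peirce_off E F X := (E - F) * X = - (X * (E - F)).

Lemma diagonal_add E F X Y :
  peirce_diag E F X -> peirce_diag E F Y -> peirce_diag E F (X + Y).
Proof.
rewrite /peirce_diag; move: (E - F) => U hX hY.
by rewrite mulrDr mulrDl hX hY.
Qed.

Lemma offdiagonal_add E F X Y :
  peirce_off E F X -> peirce_off E F Y -> peirce_off E F (X + Y).
Proof.
rewrite /peirce_off; move: (E - F) => U hX hY.
by rewrite mulrDr mulrDl opprD hX hY.
Qed.

Lemma offdiagonal_scale E F X a :
  peirce_off E F X -> peirce_off E F (a *: X).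
Proof.
by rewrite /peirce_off -bop_scalerAl -bop_scalerAr -scalerN => ->.
Qed.

Lemma corner_diagonall E F X : complementary E F -> corner E E X ->
  peirce_diag E F X.
Proof.
move=> c cX; rewrite /peirce_diag mulrBl mulrBr.
by rewrite (corner_l0 cX (cpl_rl c)) (corner_r0 cX (cpl_lr c)) cX.1 cX.2.
Qed.

Lemma corner_diagonalr E F X : complementary E F -> corner F F X ->
  peirce_diag E F X.
Proof.
move=> c cX; rewrite /peirce_diag mulrBl mulrBr.
by rewrite (corner_l0 cX (cpl_lr c)) (corner_r0 cX (cpl_rl c)) cX.1 cX.2.
Qed.

Lemma corner_offdiagonall E F X : complementary E F -> corner E F X ->
  peirce_off E F X.
Proof.
move=> c cX; rewrite /peirce_off mulrBl mulrBr.
rewrite (corner_l0 cX (cpl_rl c)) (corner_r0 cX (cpl_rl c)) cX.1 cX.2.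
by rewrite subr0 sub0r opprK.
Qed.

Lemma corner_offdiagonalr E F X : complementary E F -> corner F E X ->
  peirce_off E F X.
Proof.
move=> c cX; rewrite /peirce_off mulrBl mulrBr.
rewrite (corner_l0 cX (cpl_lr c)) (corner_r0 cX (cpl_lr c)) cX.1 cX.2.
by rewrite subr0 sub0r.
Qed.

Lemma diagonalC E F X : peirce_diag E F X -> peirce_diag F E X.
Proof. by rewrite /peirce_diag -[F - E]opprB mulNr mulrN => ->. Qed.

Lemma complementary_sym_adj E F : complementary E F -> adj (E - F) = E - F.
Proof. by move=> c; rewrite adjB (cpl_adjl c) (cpl_adjr c). Qed.

Lemma complementary_sym_sqr E F : complementary E F -> (E - F) * (E - F) = 1.
Proof.
move=> c; rewrite mulrBl !mulrBr (cpl_idl c) (cpl_idr c) (cpl_lr c) (cpl_rl c).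
by rewrite subr0 sub0r opprK (cpl_add c).
Qed.

Lemma offdiagonal_sjordan E F X D : complementary E F ->
  peirce_off E F X -> peirce_diag E F D -> peirce_off E F (sjordan X D).
Proof.
move=> c oX dD; apply: offdiagonal_add; rewrite /peirce_off.
  by rewrite mulrA oX mulNr -!mulrA dD.
have : adj ((E - F) * X) = adj (- (X * (E - F))) by rewrite oX.
rewrite adjN !adjM !(complementary_sym_adj c) => oX'.
by rewrite mulrA dD -!mulrA oX' mulrN opprK.
Qed.

Lemma offdiagonal_decomp E F X : complementary E F -> peirce_off E F X ->
  X = E * X * F + F * X * E.
Proof.
move=> c oX; rewrite {1}(@peirce_decomp _ _ X (cpl_add c)).
have h : E * X + X * E = F * X + X * F.
  move: oX; rewrite /peirce_off mulrBl mulrBr opprB.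
  by move/(canRL (subrK _)); rewrite addrAC => ->; rewrite subrK addrC.
have -> : E * X * E = 0.
  apply: bop_dbl_eq0; have /(congr1 (fun Y => E * Y * E)) := h.
  rewrite !mulrDr !mulrDl !mulrA (cpl_idl c) (cpl_lr c) !mul0r add0r.
  by rewrite -!mulrA (cpl_idl c) (cpl_rl c) !mulr0.
have -> : F * X * F = 0.
  apply: bop_dbl_eq0; have /(congr1 (fun Y => F * Y * F)) := h.
  rewrite !mulrDr !mulrDl !mulrA (cpl_idr c) (cpl_rl c) !mul0r add0r.
  by rewrite -!mulrA (cpl_idr c) (cpl_lr c) !mulr0.
by rewrite addr0 add0r.
Qed.

Lemma diagonal_comm E F X : complementary E F -> peirce_diag E F X ->
  F * X = X * F.
Proof.
move=> c; rewrite /peirce_diag.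
have -> : E = 1 - F by rewrite -(cpl_add c) addrK.
rewrite !mulrBl !mulrBr mul1r mulr1 -!addrA => /addrI.
by rewrite -!opprD => /oppr_inj /bop_dbl_inj.
Qed.

Lemma sjordan_sym_offdiagonal E F X : complementary E F ->
  peirce_off E F X -> sjordan (E - F) X = 0.
Proof.
move=> c; rewrite /sjordan (complementary_sym_adj c) /peirce_off => ->.
by rewrite addNr.
Qed.

Lemma sjordan_isym E F X : complementary E F ->
  sjordan ('i *: (E - F)) X = 'i *: ((E - F) * X - X * (E - F)).
Proof.
move=> c; rewrite /sjordan Defs.adjZ (complementary_sym_adj c) conjCi.
by rewrite -bop_scalerAl -bop_scalerAr scaleNr scalerBr.
Qed.

Lemma sjordan_isym_diagonal E F X : complementary E F -> peirce_diag E F X ->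
  sjordan ('i *: (E - F)) X = 0.
Proof. by move=> c; rewrite sjordan_isym// => ->; rewrite subrr scaler0. Qed.

(** Since [S] commutes with [F], the product of [X = F C E] with [S] has the
    component [F C E S], and primeness cancels [F M]. *)
Lemma offdiagonal_separates (M : set 'B(H)) E F S :
  von_neumann_algebra M -> prime_algebra M ->
  complementary E F -> M E -> M F -> M S -> F <> 0 ->
  (forall X, M X -> corner F E X -> sjordan X S = 0) -> peirce_diag E F S ->
  E * S = 0.
Proof.
move=> vM primeM cEF ME MF MS F0 XS dS.
have [||//|//] := primeM F (E * S) MF _ _; first by vNa_mem.
move=> C MC; have cX : corner F E (F * C * E).
  by apply: corner_mid; [exact: cpl_idr cEF | exact: cpl_idl cEF].
have /(congr1 ( *%R F)) : sjordan (F * C * E) S = 0.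
  by apply: XS => //; vNa_mem.
rewrite mulr0 /sjordan mulrDr [F * (S * _)]mulrA (diagonal_comm cEF dS).
have -> : S * F * adj (F * C * E) = 0.
  rewrite -mulrA -(corner_adj (complementaryC cEF) cX).1.
  by rewrite [F * _]mulrA (cpl_rl cEF) mul0r mulr0.
by rewrite addr0 mulrA cX.1 !mulrA.
Qed.

End Peirce.

(** * Additivity of maps preserving the *-Jordan product *)

Section JordanMaps.
Context {R : realType} {H : hilbertType R} (M : set 'B(H)).
Hypothesis vM : von_neumann_algebra M.
Hypothesis primeM : prime_algebra M.
Variable phi : 'B(H) -> 'B(H).
Hypothesis bij_phi : set_bij M M phi.
Hypothesis phiJ : forall A B, M A -> M B ->
  phi (hjordan A B) = hjordan (phi A) (phi B).
Implicit Types (A B X Y E F T : 'B(H)).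

Lemma jmap_mem A : M A -> M (phi A).
Proof. by case: bij_phi => + _ _; apply. Qed.

Lemma jmap_inj A B : M A -> M B -> phi A = phi B -> A = B.
Proof. by case: bij_phi => _ inj _ MA MB; apply: inj; rewrite inE. Qed.

Lemma jmap_surj A : M A -> exists2 B, M B & phi B = A.
Proof. by case: bij_phi => _ _ /(_ A) /[apply] -[B MB <-]; exists B. Qed.

Lemma jmap0 : phi 0 = 0.
Proof.
have [Z MZ Z0] := jmap_surj (vNa0 vM).
rewrite -[X in phi X = _](_ : hjordan 0 Z = 0).
  by rewrite phiJ ?Z0; [rewrite /hjordan /sjordan mulr0 mul0r addr0 scaler0
     | exact: vNa0|].
by rewrite /hjordan sjordan0l scaler0.
Qed.

(** Additivity at [A], [B] is proved by taking the preimage [T] of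
    [phi A + phi B] and identifying it with [A + B]. The relation between [T],
    [A] and [B] survives multiplication by any [X] on either side, so a
    multiplier that kills [B] must act in the same way on [T] and on [A]. *)
Definition image_sum T A B := [/\ M T, M A, M B & phi T = phi A + phi B].

Lemma image_sum_exists A B : M A -> M B -> exists T, image_sum T A B.
Proof.
move=> MA MB; have [T MT TE] : exists2 T, M T & phi T = phi A + phi B.
  by apply: jmap_surj; apply: vNaD => //; exact: jmap_mem.
by exists T.
Qed.

Lemma image_sumC T A B : image_sum T A B -> image_sum T B A.
Proof. by case=> *; split => //; rewrite addrC. Qed.

Lemma image_sum_hjordanl X T A B : M X -> image_sum T A B ->
  image_sum (hjordan X T) (hjordan X A) (hjordan X B).
Proof.
move=> MX [MT MA MB TE]; split; try by vNa_mem.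
by rewrite !phiJ// TE hjordanDr.
Qed.

Lemma image_sum_hjordanr X T A B : M X -> image_sum T A B ->
  image_sum (hjordan T X) (hjordan A X) (hjordan B X).
Proof.
move=> MX [MT MA MB TE]; split; try by vNa_mem.
by rewrite !phiJ// TE hjordanDl.
Qed.

Lemma image_sum0 T A : image_sum T A 0 -> T = A.
Proof. by move=> [MT MA _]; rewrite jmap0 addr0; exact: jmap_inj. Qed.

Lemma image_sum_killl X T A B : M X -> image_sum T A B -> sjordan X B = 0 ->
  sjordan X T = sjordan X A.
Proof.
move=> MX /(image_sum_hjordanl MX) + XB.
rewrite [hjordan X B]/hjordan XB scaler0 => /image_sum0.
exact: hjordan_inj.
Qed.

Lemma image_sum_killr X T A B : M X -> image_sum T A B -> sjordan B X = 0 ->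
  sjordan T X = sjordan A X.
Proof.
move=> MX /(image_sum_hjordanr MX) + XB.
rewrite [hjordan B X]/hjordan XB scaler0 => /image_sum0.
exact: hjordan_inj.
Qed.

Definition additive_at A B := phi (A + B) = phi A + phi B.

Lemma image_sum_additive A B : M A -> M B ->
  (forall T, image_sum T A B -> T = A + B) -> additive_at A B.
Proof.
move=> MA MB h; have [T sT] := image_sum_exists MA MB.
by rewrite /additive_at -(h T sT); case: sT.
Qed.

Section Corners.
Variables E F : 'B(H).
Hypothesis (cEF : complementary E F) (ME : M E) (MF : M F).

Let MU : M (E - F). Proof. exact: vNaB. Qed.
Let MiU : M ('i *: (E - F)). Proof. exact: vNaZ. Qed.

(** Left multiplication by [E - F] kills exactly the off-diagonal elements, and
    left multiplication by ['i (E - F)] kills exactly the diagonal ones. *)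
Lemma additive_diagonal_offdiagonal A B : M A -> M B ->
  peirce_diag E F A -> peirce_off E F B -> additive_at A B.
Proof.
move=> MA MB dA oB; apply: image_sum_additive => // T sT.
have := image_sum_killl MU sT (sjordan_sym_offdiagonal cEF oB).
have := image_sum_killl MiU (image_sumC sT) (sjordan_isym_diagonal cEF dA).
rewrite !(sjordan_isym _ cEF) => /(scalerI (neq0Ci _)).
have BU : B * (E - F) = - ((E - F) * B) by rewrite oB opprK.
rewrite /sjordan (complementary_sym_adj cEF) -dA BU opprK.
have := complementary_sym_sqr cEF.
move: (E - F) => U UU h1 h2.
suff UT : U * T = U * (A + B).
  by rewrite -[T]mul1r -UU -mulrA UT mulrA UU mul1r.
by apply: bop_dbl_inj; rewrite mulrDr addrACA -h2 -h1 addrACA subrr addr0.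
Qed.

(** Right multiplication by [F] kills the corner [F M E], and right
    multiplication by [E] kills the corner [E M F]. *)
Lemma additive_opposite_corners A B : M A -> M B ->
  corner E F A -> corner F E B -> additive_at A B.
Proof.
move=> MA MB cA cB; apply: image_sum_additive => // T sT.
have UT : sjordan (E - F) T = 0.
  rewrite (image_sum_killl MU sT) (sjordan_sym_offdiagonal cEF)//.
    exact: corner_offdiagonall.
  exact: corner_offdiagonalr.
have oT : peirce_off E F T.
  by apply/eqP; rewrite -addr_eq0 -{2}(complementary_sym_adj cEF) -UT.
rewrite (offdiagonal_decomp cEF oT).
have cAa := corner_adj cEF cA; have cBa := corner_adj (complementaryC cEF) cB.
have := image_sum_killr ME (image_sumC sT); have := image_sum_killr MF sT.
rewrite /sjordan (corner_r0 cA (cpl_rl cEF)) (corner_l0 cAa (cpl_lr cEF)).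
rewrite (corner_r0 cB (cpl_lr cEF)) (corner_l0 cBa (cpl_rl cEF)) addr0.
rewrite cA.2 cB.2 => /(_ erefl) hF /(_ erefl) hE.
congr (_ + _).
  move/(congr1 ( *%R E)): hF; rewrite !mulrDr !mulrA (cpl_lr cEF) !mul0r !addr0.
  by move=> ->; rewrite cA.1.
move/(congr1 ( *%R F)): hE; rewrite !mulrDr !mulrA (cpl_rl cEF) !mul0r !addr0.
by move=> ->; rewrite cB.1.
Qed.

(** The product of [E + A] and [F + B] contains [A + B] in its corner [E M F],
    while expanding it after applying [phi] produces [phi A + phi B] there. *)
Lemma additive_corner_half A B : M A -> M B -> corner E F A -> corner E F B ->
  additive_at (2%:R^-1 *: A) (2%:R^-1 *: B).
Proof.
move=> MA MB cA cB.
have MA' := vNa_adj vM MA; have MB' := vNa_adj vM MB.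
have cA' := corner_adj cEF cA; have cB' := corner_adj cEF cB.
have cE : corner E E E by split; rewrite (cpl_idl cEF).
have cF : corner F F F by split; rewrite (cpl_idr cEF).
have EF0 : hjordan E F = 0.
  rewrite /hjordan /sjordan (cpl_adjl cEF) (cpl_lr cEF) (cpl_rl cEF).
  by rewrite addr0 scaler0.
have EB : hjordan E B = 2%:R^-1 *: B.
  rewrite /hjordan /sjordan (cpl_adjl cEF) cB.1.
  by rewrite (corner_r0 cB (cpl_rl cEF)) addr0.
have AF : hjordan A F = 2%:R^-1 *: A + 2%:R^-1 *: adj A.
  by rewrite /hjordan /sjordan cA.2 cA'.1 scalerDr.
have AB : hjordan A B = 2%:R^-1 *: (B * adj A).
  by rewrite /hjordan /sjordan (corner_mul0 cA cB (cpl_rl cEF)) add0r.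
have : phi (hjordan (E + A) (F + B)) = phi (hjordan E F) + phi (hjordan E B) +
    (phi (hjordan A F) + phi (hjordan A B)).
  rewrite !phiJ//; try by vNa_mem.
  rewrite (additive_diagonal_offdiagonal ME MA)
    ?(additive_diagonal_offdiagonal MF MB);
    try by [exact: corner_diagonall | exact: corner_diagonalr
      | exact: corner_offdiagonall].
  by rewrite hjordanDl !hjordanDr.
rewrite hjordanDl !hjordanDr EF0 EB AF AB jmap0 !add0r.
set a := _ *: A; set b := _ *: B; set a' := _ *: adj A; set d := _ *: (B * _).
have [ca cb] : corner E F a /\ corner E F b by split; exact: corner_scale.
have ca' : corner F E a' by exact: corner_scale.
have cd : corner E E d by apply/corner_scale/corner_mul/cA'.
have [Ma [Mb [Ma' Md]]] : M a /\ M b /\ M a' /\ M d.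
  by split; [|split; [|split]]; vNa_mem.
rewrite (additive_opposite_corners Ma Ma')// !addrA addrC.
rewrite additive_diagonal_offdiagonal; first last.
- apply: offdiagonal_add; last exact: corner_offdiagonalr.
  by apply: corner_offdiagonall => //; exact: corner_add.
- exact: corner_diagonall.
- by vNa_mem.
- by vNa_mem.
rewrite [phi d + _]addrC => /addIr.
rewrite additive_opposite_corners//; [|by vNa_mem|exact: corner_add].
by move/addIr; rewrite /additive_at addrC => ->; rewrite addrC.
Qed.

Lemma additive_corner A B : M A -> M B -> corner E F A -> corner E F B ->
  additive_at A B.
Proof.
move=> MA MB cA cB; rewrite -[A]bop_half -[B]bop_half -!scalerDr.
by apply: additive_corner_half;
  [vNa_mem|vNa_mem|exact: corner_add|exact: corner_add].
Qed.

End Corners.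

Section Blocks.
Variables E F : 'B(H).
Hypothesis (cEF : complementary E F) (ME : M E) (MF : M F).
Hypothesis (E0 : E <> 0) (F0 : F <> 0).

Let cFE : complementary F E. Proof. exact: complementaryC. Qed.

Lemma additive_offdiagonal A B : M A -> M B ->
  peirce_off E F A -> peirce_off E F B -> additive_at A B.
Proof.
move=> MA MB /(offdiagonal_decomp cEF) eA /(offdiagonal_decomp cEF) eB.
have cE X : corner E F (E * X * F).
  by apply: corner_mid; [exact: cpl_idl cEF | exact: cpl_idr cEF].
have cF X : corner F E (F * X * E).
  by apply: corner_mid; [exact: cpl_idr cEF | exact: cpl_idl cEF].
have adds X Y : M X -> M Y -> corner E F X -> corner F E Y -> additive_at X Y.
  exact: additive_opposite_corners.
have [mA mB] : M (E * A * F) /\ M (E * B * F) by split; vNa_mem.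
have [mA' mB'] : M (F * A * E) /\ M (F * B * E) by split; vNa_mem.
have e : additive_at (E * A * F + E * B * F) (F * A * E + F * B * E).
  by apply: adds; [exact: vNaD|exact: vNaD|exact: (corner_add (cE _) (cE _))
    |exact: (corner_add (cF _) (cF _))].
have e1 : additive_at (E * A * F) (E * B * F).
  exact: (additive_corner cEF ME MF mA mB).
have e2 : additive_at (F * A * E) (F * B * E).
  exact: (additive_corner cFE MF ME mA' mB').
have eA' := adds _ _ mA mA' (cE A) (cF A).
have eB' := adds _ _ mB mB' (cE B) (cF B).
by rewrite /additive_at eA eB addrACA e e1 e2 eA' eB' addrACA.
Qed.

(** Multiplying by an off-diagonal [X] moves diagonal elements into the
    off-diagonal part, where additivity is known; primeness recovers the
    diagonal elements from these products. *)
Lemma additive_diagonal A B : M A -> M B ->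
  peirce_diag E F A -> peirce_diag E F B -> additive_at A B.
Proof.
move=> MA MB dA dB; apply: image_sum_additive => // T sT.
have MT : M T by case: sT.
have MiU : M ('i *: (E - F)) by vNa_mem.
have dT : peirce_diag E F T.
  have /eqP := image_sum_killl MiU sT (sjordan_isym_diagonal cEF dB).
  rewrite (sjordan_isym_diagonal cEF dA) (sjordan_isym _ cEF).
  by rewrite scaler_eq0 (negPf (neq0Ci _)) subr_eq0 => /eqP.
have offX X : M X -> peirce_off E F X -> sjordan X (T - (A + B)) = 0.
  move=> MX oX; have [Mh MhA MhB] := image_sum_hjordanl MX sT.
  have off D : peirce_diag E F D -> peirce_off E F (hjordan X D).
    by move=> dD; apply/offdiagonal_scale/offdiagonal_sjordan.
  rewrite -additive_offdiagonal//; try exact: off.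
  rewrite -hjordanDr => /jmap_inj h.
  by rewrite sjordanBr (hjordan_inj (h _ _)) ?subrr//; vNa_mem.
have dS : peirce_diag E F (T - (A + B)).
  have dN X : peirce_diag E F X -> peirce_diag E F (- X).
    by rewrite /peirce_diag mulrN mulNr => ->.
  by apply: diagonal_add => //; apply/dN/diagonal_add.
have MS : M (T - (A + B)) by vNa_mem.
apply/eqP; rewrite -subr_eq0; apply/eqP.
rewrite -[LHS]mul1r -(cpl_add cEF) mulrDl.
rewrite (offdiagonal_separates vM primeM cEF)//; last first.
  by move=> X MX cX; apply: offX => //; exact: corner_offdiagonalr.
rewrite (offdiagonal_separates vM primeM cFE) ?addr0//; last exact: diagonalC.
by move=> X MX cX; apply: offX => //; exact: corner_offdiagonall.
Qed.

Lemma jmap_additive A B : M A -> M B -> additive_at A B.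
Proof.
pose D X := E * X * E + F * X * F; pose O X := E * X * F + F * X * E.
have DO X : X = D X + O X by exact: (peirce_decomp _ (cpl_add cEF)).
have idem := (cpl_idl cEF, cpl_idr cEF).
have dD X : peirce_diag E F (D X).
  apply: diagonal_add.
    by apply: corner_diagonall => //; apply: corner_mid; rewrite idem.
  by apply: corner_diagonalr => //; apply: corner_mid; rewrite idem.
have oO X : peirce_off E F (O X).
  apply: offdiagonal_add.
    by apply: corner_offdiagonall => //; apply: corner_mid; rewrite idem.
  by apply: corner_offdiagonalr => //; apply: corner_mid; rewrite idem.
move=> MA MB.
have [MDA MDB] : M (D A) /\ M (D B) by split; rewrite /D; vNa_mem.
have [MOA MOB] : M (O A) /\ M (O B) by split; rewrite /O; vNa_mem.
have adds X Y : M X -> M Y -> peirce_diag E F X -> peirce_off E F Y ->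
    phi (X + Y) = phi X + phi Y by exact: additive_diagonal_offdiagonal.
have eD : phi (D A + D B) = phi (D A) + phi (D B) by exact: additive_diagonal.
have eO : phi (O A + O B) = phi (O A) + phi (O B).
  exact: additive_offdiagonal.
have e : phi (D A + D B + (O A + O B)) = phi (D A + D B) + phi (O A + O B).
  by apply: adds; [exact: vNaD|exact: vNaD|exact: diagonal_add
    |exact: offdiagonal_add].
rewrite /additive_at [in LHS](DO A) [in LHS](DO B) addrACA e eD eO addrACA.
by rewrite -(adds (D A))// -(adds (D B))// -!DO.
Qed.

End Blocks.

End JordanMaps.

(** * Multiplicativity on a factor *)

Section Isomorphism.
Context {R : realType} {H : hilbertType R} (M : set 'B(H)).
Hypothesis fM : vN_factor M.
Variable phi : 'B(H) -> 'B(H).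
Hypothesis bij_phi : set_bij M M phi.
Hypothesis phiJ : forall A B, M A -> M B ->
  phi (hjordan A B) = hjordan (phi A) (phi B).
Hypothesis phi1 : phi 1 = 1.
Variable P : 'B(H).
Hypotheses (MP : M P) (nP : nontrivial_projection P).
Implicit Types (A B X Y S : 'B(H)).

Local Notation iOne := ('i *: (1 : 'B(H))).

Let vM : von_neumann_algebra M := fM.1.
Let primeM : prime_algebra M := factor_prime fM.
Let Mphi A : M A -> M (phi A) := @jmap_mem _ _ M phi bij_phi A.
Let jmap0 : phi 0 = 0 := jmap0 vM bij_phi phiJ.

Lemma jmapD A B : M A -> M B -> phi (A + B) = phi A + phi B.
Proof.
have [prP P0 P1] := nP.
have Q0 : 1 - P <> 0 by move/eqP; rewrite subr_eq0 eq_sym => /eqP.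
have cP := projection_complementary prP.
apply: (jmap_additive vM primeM bij_phi phiJ cP) => //.
by apply: vNaB => //; exact: vNa1.
Qed.

Lemma jmapN A : M A -> phi (- A) = - phi A.
Proof.
move=> MA; apply/eqP; rewrite -addr_eq0 -jmapD//; last exact: vNaN.
by rewrite addNr jmap0.
Qed.

Lemma jmapB A B : M A -> M B -> phi (A - B) = phi A - phi B.
Proof. by move=> MA MB; rewrite jmapD ?jmapN//; exact: vNaN. Qed.

Lemma jmap_sjordan A B : M A -> M B ->
  phi (sjordan A B) = sjordan (phi A) (phi B).
Proof.
move=> MA MB; rewrite -hjordan_dbl jmapD ?phiJ ?hjordan_dbl//;
  exact: vNa_hjordan.
Qed.

Lemma jmap_adj A : M A -> phi (adj A) = adj (phi A).
Proof.
move=> MA; have M1 := vNa1 vM; have MA' := vNa_adj vM MA.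
by apply: (addrI (phi A)); rewrite -jmapD// -!sjordan1r jmap_sjordan// phi1.
Qed.

(** [sjordan ('i *: 1) X = 0] for every [X]. Applying [phi] shows first, at
    [X = 1], that the image of ['i] is skew-adjoint, and then that it is
    central. *)
Lemma jmap_scalar_i : exists l : Cplx R, phi iOne = l *: (1 : 'B(H)).
Proof.
have M1 := vNa1 vM; have Mi : M iOne by exact: vNaZ.
have Mphii := Mphi Mi.
have comm X : M X -> phi iOne * X + X * adj (phi iOne) = 0.
  move=> MX; have [Y MY <-] := jmap_surj bij_phi MX.
  rewrite -/(sjordan _ _) -jmap_sjordan// /sjordan Defs.adjZ conjCi Defs.adj1.
  rewrite -bop_scalerAl -bop_scalerAr mul1r mulr1 scaleNr subrr.
  exact: jmap0.
have [] := fM.2 (phi iOne).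
  split=> // X MX; have := comm _ MX; have := comm _ M1.
  rewrite mulr1 mul1r => /eqP; rewrite addrC addr_eq0 => /eqP ->.
  by rewrite mulrN => /eqP; rewrite subr_eq0 => /eqP.
by move=> l _ <-; exists l.
Qed.

Lemma jmap_iselfadj l S :
  phi iOne = l *: (1 : 'B(H)) -> M S -> adj S = S ->
  phi ('i *: S) = l *: phi S.
Proof.
move=> lE MS aS; have M1 := vNa1 vM; have Mi : M iOne by exact: vNaZ.
have MiS : M ('i *: S) by exact: vNaZ.
apply: bop_dbl_inj; rewrite -jmapD//.
have -> : 'i *: S + 'i *: S = sjordan S iOne.
  by rewrite /sjordan aS -bop_scalerAr -bop_scalerAl mul1r mulr1.
rewrite jmap_sjordan// lE /sjordan -jmap_adj// aS.
by rewrite -bop_scalerAr -bop_scalerAl mul1r mulr1.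
Qed.

Lemma jmap_icommutator l S X : phi iOne = l *: (1 : 'B(H)) ->
  M S -> adj S = S -> M X ->
  phi ('i *: (S * X - X * S)) = l *: (phi S * phi X - phi X * phi S).
Proof.
move=> lE MS aS MX; have MiS : M ('i *: S) by exact: vNaZ.
have -> : 'i *: (S * X - X * S) = sjordan ('i *: S) X.
  rewrite /sjordan Defs.adjZ aS conjCi -bop_scalerAl -bop_scalerAr scaleNr.
  by rewrite scalerBr.
rewrite jmap_sjordan// /sjordan -jmap_adj// Defs.adjZ aS conjCi scaleNr jmapN//.
rewrite (jmap_iselfadj lE)// mulrN scalerBr.
by rewrite bop_scalerAl bop_scalerAr.
Qed.

(** A nonzero corner element [X = P C (1 - P)] satisfies [P X - X P = X], so two
    uses of [jmap_icommutator] give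
    [- phi X = l ^ 2 [phi P, [phi P, phi X]]]. The double commutator is [phi X],
    because [phi P phi X + phi X phi P = phi X] with [phi P] idempotent. *)
Lemma jmap_i_sqr l : phi iOne = l *: (1 : 'B(H)) -> l * l = -1.
Proof.
move=> lE; have [prP P0 P1] := nP; have [aP PP] := prP.
have M1 := vNa1 vM.
have Q0 : 1 - P <> 0 by move/eqP; rewrite subr_eq0 eq_sym => /eqP.
have MQ : M (1 - P) by exact: vNaB.
have cPQ := projection_complementary prP.
have [C MC C0] : exists2 C, M C & P * C * (1 - P) <> 0.
  apply: contrapT => h.
  have [] // := primeM MP MQ.
  by move=> C MC; apply: contrapT => C0; apply: h; exists C.
pose X := P * C * (1 - P).
have MX : M X by rewrite /X; vNa_mem.
have cX : corner P (1 - P) X by apply: corner_mid; rewrite ?(cpl_idr cPQ).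
have PX : P * X = X := cX.1.
have XP : X * P = 0 by exact: corner_r0 cX (cpl_rl cPQ).
have phiPX := jmap_sjordan MP MX.
rewrite /sjordan -jmap_adj// aP PX XP addr0 in phiPX.
have pPP : phi P * phi P = phi P.
  have := jmap_sjordan MP MP; rewrite /sjordan -jmap_adj// aP PP.
  by rewrite jmapD// => /bop_dbl_inj.
have PXP : phi P * phi X * phi P = 0.
  have /(congr1 ( *%R (phi P))) := phiPX.
  rewrite mulrDr mulrA pPP => /eqP; rewrite -subr_eq0 opprD addrA subrr sub0r.
  by rewrite oppr_eq0 mulrA => /eqP.
have MiX : M ('i *: X) by exact: vNaZ.
have e1 : phi ('i *: X) = l *: (phi P * phi X - phi X * phi P).
  by rewrite -jmap_icommutator// PX XP subr0.
have := jmap_icommutator lE MP aP MiX.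
rewrite -bop_scalerAl -bop_scalerAr PX XP scaler0 subr0 e1.
rewrite scalerA -expr2 sqrCi scaleN1r jmapN//.
rewrite -bop_scalerAl -bop_scalerAr -scalerBr scalerA mulrBl mulrBr.
rewrite mulrA pPP PXP -[phi X * phi P * phi P]mulrA pPP mulrA PXP sub0r subr0.
rewrite opprK -phiPX => h.
have pX0 : phi X <> 0.
  rewrite -jmap0 => /(jmap_inj bij_phi MX (vNa0 vM)).
  exact: C0.
have : (l * l + 1) *: phi X = 0 by rewrite scalerDl -h scale1r addNr.
by move/eqP; rewrite scaler_eq0 addr_eq0 => /orP[/eqP|/eqP].
Qed.

Lemma bop_selfadj_decomp X : exists S T : 'B(H),
  [/\ adj S = S, adj T = T, X = S + 'i *: T &
      forall N, von_neumann_algebra N -> N X -> N S /\ N T].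
Proof.
exists (2%:R^-1 *: (X + adj X)), ((2%:R^-1 * - 'i) *: (X - adj X)).
have c2 : Num.conj (2%:R^-1 : Cplx R) = 2%:R^-1.
  by rewrite fmorphV rmorph_nat.
split.
- by rewrite Defs.adjZ adjD adjK c2 addrC.
- have -> : adj ((2%:R^-1 * - 'i) *: (X - adj X)) =
      (2%:R^-1 * 'i) *: (adj X - X).
    rewrite Defs.adjZ adjB adjK; congr (_ *: _).
    rewrite rmorphM rmorphN; congr (_ * _); rewrite // -[RHS]opprK.
    by congr (- _); exact: conjCi.
  by rewrite -[adj X - X]opprB scalerN -scaleNr mulrN.
- rewrite scalerA mulrCA mulrN -expr2 sqrCi opprK mulr1 -scalerDr.
  by rewrite addrACA subrr addr0 scalerDr bop_half.
- by move=> N vN NX; split; vNa_mem.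
Qed.

Lemma jmapZi l X : phi iOne = l *: (1 : 'B(H)) -> M X ->
  phi ('i *: X) = l *: phi X.
Proof.
move=> lE MX; have [S [T [aS aT dec /(_ _ vM MX)[MS MT]]]] :=
  bop_selfadj_decomp X.
have [MiS MiT] : M ('i *: S) /\ M ('i *: T) by split; exact: vNaZ.
rewrite dec scalerDr scalerA -expr2 sqrCi scaleN1r jmapB// jmapD//.
rewrite !(jmap_iselfadj lE)// scalerDr scalerA (jmap_i_sqr lE).
by rewrite scaleN1r.
Qed.

(** For self-adjoint [S], [S X] is half the sum of [S X + X S] and the
    commutator of [S] and [X], and [phi] preserves both. *)
Lemma jmapM A B : M A -> M B -> phi (A * B) = phi A * phi B.
Proof.
have [l lE] := jmap_scalar_i.
have ll := jmap_i_sqr lE.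
have l0 : l != 0.
  by apply/eqP => l0; move/eqP: ll; rewrite l0 mul0r eq_sym oppr_eq0 oner_eq0.
have selfadj S X : M S -> adj S = S -> M X -> phi (S * X) = phi S * phi X.
  move=> MS aS MX.
  have MSX : M (S * X) by exact: vNaM.
  have MXS : M (X * S) by exact: vNaM.
  have MC : M (S * X - X * S) by exact: vNaB.
  have := jmap_icommutator lE MS aS MX.
  rewrite (jmapZi lE MC) => /(scalerI l0); rewrite jmapB// => e1.
  have := jmap_sjordan MS MX; rewrite /sjordan -jmap_adj// aS jmapD// => e2.
  apply: bop_dbl_inj; have := congr2 +%R e2 e1.
  by rewrite addrACA subrr addr0 addrACA subrr addr0.
move=> MA MB; have [S [T [aS aT dec /(_ _ vM MA)[MS MT]]]] :=
  bop_selfadj_decomp A.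
have MiT : M ('i *: T) by exact: vNaZ.
have MSB : M (S * B) by exact: vNaM.
have MTB : M (T * B) by exact: vNaM.
rewrite dec mulrDl -bop_scalerAl !jmapD//; last exact: vNaZ.
by rewrite !(jmapZi lE)// !selfadj// mulrDl bop_scalerAl.
Qed.

End Isomorphism.

(** * Reduction of n-fold products to binary ones, and the converse *)

Section Reduction.
Context {R : realType} {H : hilbertType R} (M : set 'B(H)).
Hypothesis vM : von_neumann_algebra M.
Variables (phi : 'B(H) -> 'B(H)) (m : nat).
Hypothesis phi1 : phi 1 = 1.
Hypothesis phiN : sjordan_nmap m.+2 M phi.
Implicit Types A B : 'B(H).

Lemma nmap_sjordan A B : M A -> M B ->
  phi ((2%:R : Cplx R) ^+ m *: sjordan A B) =
  (2%:R : Cplx R) ^+ m *: sjordan (phi A) (phi B).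
Proof.
move=> MA MB; pose s := nseq m 1 ++ [:: A; B].
have sz : size s == m.+2 by rewrite size_cat size_nseq addnC.
have Ms : forall i, M (tnth (Tuple sz) i).
  move=> i; rewrite (tnth_nth 0) /=.
  have : nth 0 s i \in s by rewrite mem_nth// (eqP sz).
  rewrite mem_cat !inE => /orP[|/orP[]/eqP->//].
  by rewrite mem_nseq => /andP[_ /eqP ->]; exact: vNa1.
have := phiN Ms; rewrite /= sjordan_seq_ones map_cat map_nseq phi1 /=.
by rewrite sjordan_seq_ones.
Qed.

(** The previous lemma at [A = 1] makes [phi] homogeneous for the factor
    [2 ^ m.+1], which can then be taken out on both sides. *)
Lemma nmap_hjordan A B : M A -> M B ->
  phi (hjordan A B) = hjordan (phi A) (phi B).
Proof.
move=> MA MB.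
have two0 : (2%:R : Cplx R) != 0 by rewrite pnatr_eq0.
have homog X : M X -> phi ((2%:R : Cplx R) ^+ m.+1 *: X) =
    (2%:R : Cplx R) ^+ m.+1 *: phi X.
  move=> MX; have := nmap_sjordan (vNa1 vM) MX.
  by rewrite phi1 !sjordan1l !bop_dbl !scalerA -!exprSr.
have h2 X Y : (2%:R : Cplx R) ^+ m *: sjordan X Y =
    (2%:R : Cplx R) ^+ m.+1 *: hjordan X Y.
  by rewrite /hjordan scalerA exprSr mulfK.
have := nmap_sjordan MA MB; rewrite !h2 homog; last exact: vNa_hjordan.
by apply: scalerI; rewrite expf_neq0.
Qed.

End Reduction.

Section Converse.
Context {R : realType} {H : hilbertType R} (M : set 'B(H)).
Hypothesis vM : von_neumann_algebra M.
Variable phi : 'B(H) -> 'B(H).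
Hypothesis iso : star_ring_isomorphism M phi.
Implicit Types (A B : 'B(H)) (s : seq 'B(H)).

(** By surjectivity [1 = phi U], so [phi 1 = phi 1 * phi U = phi U]. *)
Lemma star_iso1 : phi 1 = 1.
Proof.
have [U MU U1] := jmap_surj (sri_bij iso) (vNa1 vM).
by have := sriM iso (vNa1 vM) MU; rewrite mul1r U1 mulr1.
Qed.

Lemma star_iso_sjordan A B : M A -> M B ->
  phi (sjordan A B) = sjordan (phi A) (phi B).
Proof.
move=> MA MB; have MA' := vNa_adj vM MA.
by rewrite /sjordan (sriD iso) ?(sriM iso) ?(sri_adj iso)//; exact: vNaM.
Qed.

Lemma star_iso_foldl A s : M A -> (forall B, B \in s -> M B) ->
  phi (foldl sjordan A s) = foldl sjordan (phi A) (map phi s).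
Proof.
elim: s A => //= B s IH A MA Ms.
have MB : M B by apply: Ms; rewrite mem_head.
rewrite IH ?star_iso_sjordan//; first exact: vNa_sjordan.
by move=> C Cs; apply: Ms; rewrite inE Cs orbT.
Qed.

Lemma star_iso_nmap n : sjordan_nmap n.+1 M phi.
Proof.
case=> -[//|A s] sz Ms; have Mx B : B \in A :: s -> M B.
  move=> /(nthP 0) [k]; rewrite (eqP sz) => ltk <-.
  by have := Ms (Ordinal ltk); rewrite (tnth_nth 0).
rewrite /= star_iso_foldl//; first by apply: Mx; rewrite mem_head.
by move=> B Bs; apply: Mx; rewrite inE Bs orbT.
Qed.

End Converse.

Theorem corollary3p4 (R : realType) (H : hilbertType R) (n : nat)
    (hn : (2 <= n)%N) (M : set 'B(H)) (hM : vN_factor M)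
    (hP : exists2 P, M P & nontrivial_projection P)
    (phi : {fun M >-> M}) :
  [/\ set_bij M M phi, phi 1 = 1 & sjordan_nmap n M phi]
  <-> star_ring_isomorphism M phi.
Proof.
have vM := hM.1; case: n hn => [|[|m]] // _.
split=> [[bij phi1 phin]|iso]; last first.
  by split; [exact: sri_bij|exact: star_iso1 iso|exact: star_iso_nmap].
have [P MP nP] := hP.
have phiJ := nmap_hjordan vM phi1 phin.
split=> // A; [move=> B MA MB|move=> B MA MB|move=> MA].
- exact: (jmapD hM bij phiJ MP nP).
- exact: (jmapM hM bij phiJ phi1 MP nP).
- exact: (jmap_adj hM bij phiJ phi1 MP nP).
Qed.
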